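(* Let $G$ be a countable discrete sofic group and $\sigma_k\colon G\to S_{d_k}$ a sofic approximation. Fix a free ultrafilter $\omega$ on the natural numbers. Let $G\curvearrowright X$ be an algebraic action. Then the following are equivalent: (i) There does not exist a sequence $\mu_k\in\mathrm{Prob}(X^{d_k})$ which is asymptotically supported on topological microstates as $k\to\omega$ and which locally weak$^*$-converges to $m_X$ as $k\to\omega$. (ii) There is a sequence $(Y_k)_k\in\prod_k\mathrm{Sub}(X)^{d_k}$ with $\lim_{k\to\omega}(Y_k)_*(u_{d_k})\neq\delta_X$ (limit in the weak$^*$ topology of $\mathrm{Prob}(\mathrm{Sub}(X))$, $\delta_X$ being the point mass at $X\in\mathrm{Sub}(X)$) such that $(Y_k)_k$ absorbs all topological microstates for $G\curvearrowright X$ along $\omega$.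
   Context: $S_n$ is the symmetric group on $\{1,\dots,n\}$, $u_n$ the uniform probability measure on $\{1,\dots,n\}$, $d_{\mathrm{Hamm}}(p,q)=u_n(\{j:p(j)\ne q(j)\})$. A sofic approximation of $G$ is a sequence of maps $\sigma_k\colon G\to S_{d_k}$ (not necessarily homomorphisms) with $d_k\to\infty$, $d_{\mathrm{Hamm}}(\sigma_k(gh),\sigma_k(g)\sigma_k(h))\to 0$ for all $g,h$ and $d_{\mathrm{Hamm}}(\sigma_k(g),\sigma_k(h))\to 1$ for $g\neq h$. An algebraic action is an action by continuous automorphisms of a compact metrizable group $X$; $m_X$ is the Haar probability measure. $\mathrm{Sub}(X)$ is the space of closed subgroups of $X$ with the Hausdorff-metric topology. For a set $A$, $A^n$ is identified with the set of maps $\{1,\dots,n\}\to A$; so $Y_k\colon\{1,\dots,d_k\}\to\mathrm{Sub}(X)$ and $(Y_k)_*(u_{d_k})\in\mathrm{Prob}(\mathrm{Sub}(X))$. For $\nu\in\mathrm{Prob}(X^{d})$, $\nu_j\in\mathrm{Prob}(X)$ is its $j$-th marginal. $(\mu_k)_k\in\prod_k\mathrm{Prob}(X^{d_k})$ is asymptotically supported on topological microstates as $k\to\omega$ if for all $g\in G$, $\delta>0$ and every neighborhood $U$ of the diagonal in $X\times X$, $\lim_{k\to\omega}\mu_k(\{\phi:u_{d_k}(\{j:(\phi(\sigma_k(g)(j)),g\phi(j))\in U\})\ge1-\delta\})=1$. $\mu_k$ locally weak$^*$-converges to $\mu\in\mathrm{Prob}(X)$ as $k\to\omega$ if $\lim_{k\to\omega}u_{d_k}(\{j:\mu_{k,j}\in\mathcal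 O\})=1$ for every weak$^*$ neighborhood $\mathcal O$ of $\mu$. A sequence $\phi_k\in X^{d_k}$ is a sequence of topological microstates with respect to $\omega$ if $\lim_{k\to\omega}u_{d_k}(\{j:(g\phi_k(j),\phi_k(\sigma_k(g)(j)))\in U\})=1$ for every $g\in G$ and every neighborhood $U$ of the diagonal. $(Y_k)_k$ absorbs all topological microstates along $\omega$ if, for a compatible metric $\rho$ on $X$, every sequence $(\phi_k)_k$ of topological microstates with respect to $\omega$ and every $\varepsilon>0$, $\lim_{k\to\omega}u_{d_k}(\{j:\rho(\phi_k(j),Y_k(j))<\varepsilon\})=1$, where $\rho(x,K)=\inf_{y\in K}\rho(x,y)$. *)

(* Defs.v *)
From HB Require Import structures.
From mathcomp Require Import all_boot all_order all_algebra all_fingroup finmap.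
From mathcomp Require Import all_classical all_reals all_analysis.

Set Implicit Arguments.
Unset Strict Implicit.
Unset Printing Implicit Defensive.

Import Order.TTheory GRing.Theory Num.Theory.
Import numFieldNormedType.Exports.

Local Open Scope classical_set_scope.
Local Open Scope ring_scope.

(* [borel T] carries the Borel sigma-algebra of T, [Prob R T] is the set of
   Borel probability measures on T.  As everywhere in the library, the value of
   a measure on a non-measurable set is meaningless. *)

Definition borel (T : ptopologicalType) := g_sigma_algebraType (@open T).

Definition Prob (R : realType) (T : ptopologicalType) :=
  probability (borel T) R.

Definition point_mass (R : realType) (T : ptopologicalType) (x : T) :
  Prob R T := \d_(x : borel T).

HB.instance Definition _ (I : Type) (T : I -> ptopologicalType) :=
  isPointed.Build (prod_topology T) (fun=> point).

Section WeakStar.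
Variables (R : realType) (T : ptopologicalType).

Definition integrals (mu : Prob R T) :
    {ptws {f : T -> R | continuous f} -> R} :=
  fun f => (\int[mu]_x (sval f x : R))%R.

(* The weak* topology: the coarsest topology making [mu |-> \int f dmu]
   continuous for all continuous f.  It is only used for compact T, where every
   continuous f is bounded. *)
HB.instance Definition _ :=
  Topological.copy (Prob R T) (initial_topology integrals).

End WeakStar.

Section Uniform.
Variable R : realType.

(* The uniform probability measure u_n on 'I_n (for n > 0). *)
Definition unif n (A : set 'I_n) : R :=
  #|[pred j | `[< A j >]]|%:R / n%:R.

Definition hamming n (p q : 'S_n) : R := unif [set j | p j <> q j].

Section Pushforward.
Variables (T : ptopologicalType) (n : nat).

Definition unif_image (n_gt0 : (0 < n)%N) (f : 'I_n -> T) (A : set (borel T)) :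
  \bar R := (unif (f @^-1` A))%:E.

Variables (n_gt0 : (0 < n)%N) (f : 'I_n -> T).

Let nth_f k : T := if insub k is Some j then f j else point.

Lemma unif_imageE :
  unif_image n_gt0 f = mscale (n%:R^-1)%:nng
    (msum (fun k => \d_(nth_f k : borel T)) n).
Proof.
apply/funext => A; rewrite /unif_image /unif /mscale /msum/= mulrC EFinM.
congr (_ * _)%E; rewrite -sum1_card natr_sum -sumEFin big_mkcond/=.
apply: eq_bigr => j _; transitivity ((nth_f j \in A)%:R%:E : \bar R) => //.
rewrite /nth_f valK inE.
by case: asboolP => Aj; [rewrite mem_set|rewrite memNset].
Qed.

Let unif_image0 : unif_image n_gt0 f set0 = 0%E.
Proof. by rewrite unif_imageE measure0. Qed.

Let unif_image_ge0 A : (0 <= unif_image n_gt0 f A)%E.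
Proof. by rewrite unif_imageE measure_ge0. Qed.

Let unif_image_sigma_additive : semi_sigma_additive (unif_image n_gt0 f).
Proof. by rewrite unif_imageE; exact: measure_semi_sigma_additive. Qed.

HB.instance Definition _ := isMeasure.Build _ _ _ (unif_image n_gt0 f)
  unif_image0 unif_image_ge0 unif_image_sigma_additive.

Let unif_image_setT : unif_image n_gt0 f setT = 1%E.
Proof.
rewrite /unif_image /unif preimage_setT.
rewrite (_ : #|_| = n) ?divff ?pnatr_eq0 -?lt0n//.
by rewrite -[RHS]card_ord; apply: eq_card => j; rewrite !inE; apply/asboolP.
Qed.

HB.instance Definition _ := Measure_isProbability.Build _ _ _
  (unif_image n_gt0 f) unif_image_setT.

Definition unif_pushforward : Prob R T := unif_image n_gt0 f.

End Pushforward.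
End Uniform.
Arguments unif R {n} A.

Section Marginal.
Variables (R : realType) (T : ptopologicalType) (n : nat).

Definition coordinate (j : 'I_n) (phi : borel {ptws 'I_n -> T}) : borel T :=
  phi j.

Let measurable_coordinate j : measurable_fun setT (coordinate j).
Proof.
apply: (@measurability _ _ _ _ setT (coordinate j) (@open T)) => //.
move=> _ [U oU <-]; rewrite setTI; apply: sub_sigma_algebra => /=.
by apply: open_comp oU => phi _; exact: (@proj_continuous _ (fun=> T) j).
Qed.

HB.instance Definition _ j := isMeasurableFun.Build _ _ _ _ (coordinate j)
  (measurable_coordinate j).

Definition marginal (nu : Prob R {ptws 'I_n -> T}) (j : 'I_n) : Prob R T :=
  distribution nu (coordinate j).

End Marginal.

HB.mixin Record isCompactGroup X & Topological X & monoid.Group X := {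
  mulg_continuous : continuous (fun x : X * X => (x.1 * x.2)%g);
  invg_continuous : continuous (fun x : X => x^-1%g);
  group_compact : compact [set: X]
}.

#[short(type="compactGroupType")]
HB.structure Definition CompactGroup :=
  { X of Topological X & monoid.Group X & isCompactGroup X }.

(* Compact metrizable groups, with a fixed compatible metric.  The measurable
   types of the library have to be pointed; the point plays no other role. *)
#[short(type="compactMetricGroupType")]
HB.structure Definition CompactMetricGroup (R : realType) :=
  { X of CompactGroup X & Metric R X & Pointed X }.

Section closedSubgroup.
Variables (R : realType) (X : compactMetricGroupType R).

Definition setdist (x : X) (K : set X) : R := inf [set mdist x y | y in K].

Record closedSubgroup := ClosedSubgroup {
  csub_set :> set X;
  csub_closed : closed csub_set;
  csub_1 : csub_set 1%g;
  csub_M : forall x y, csub_set x -> csub_set y -> csub_set (x * y)%g;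
  csub_V : forall x, csub_set x -> csub_set x^-1%g
}.

HB.instance Definition _ := gen_eqMixin closedSubgroup.
HB.instance Definition _ := gen_choiceMixin closedSubgroup.

Lemma csub_inj (K L : closedSubgroup) : K = L :> set X -> K = L.
Proof.
case: K => K cK K1 KM KV; case: L => L cL L1 LM LV /= KL.
by subst L; congr ClosedSubgroup; exact: Prop_irrelevance.
Qed.

Definition full_subgroup : closedSubgroup :=
  @ClosedSubgroup setT closedT I (fun _ _ _ _ => I) (fun _ _ => I).

Definition thickening (e : R) (K : set X) : set X :=
  [set x | exists2 y, K y & mdist x y < e].

Definition hausdorff_dist (K L : closedSubgroup) : R :=
  inf [set e | [/\ 0 < e, K `<=` thickening e L & L `<=` thickening e K]].

Let mdist_bounded : exists2 M : R, 0 < M & forall x y : X, mdist x y < M.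
Proof.
have := @group_compact X; rewrite compact_cover.
move=> /(_ nat setT (fun n => (ball (1%g : X) n.+1%:R)°)).
case.
- by move=> n _; exact: open_interior.
- move=> x _; exists (Num.trunc (mdist (1%g : X) x)).+1 => //.
  apply/nbhs_ballP; exists 1 => //= y xy; rewrite -addn1 natrD.
  apply: ball_triangle xy; rewrite ballEmdist/=.
  by rewrite truncnS_gt.
move=> D _ covD.
pose N := (\max_(i <- D) i)%N.
have H x : mdist (1%g : X) x < N.+1%:R.
  have [i /= iD /interior_subset] := covD x I.
  rewrite ballEmdist/= => /lt_le_trans; apply.
  by rewrite ler_nat ltnS /N; exact: leq_bigmax_seq.
exists (N.+1%:R + N.+1%:R); first by rewrite addr_gt0.
move=> x y; rewrite (le_lt_trans (metric_triangle _ 1%g _))// ltrD//.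
by rewrite metric_sym.
Qed.

Let HS (K L : closedSubgroup) : set R :=
  [set e | [/\ 0 < e, K `<=` thickening e L & L `<=` thickening e K]].

Let HS_neq0 K L : HS K L !=set0.
Proof.
have [M M0 HM] := mdist_bounded; exists M; split => // x _.
- by exists 1%g => //; exact: csub_1.
- by exists 1%g => //; exact: csub_1.
Qed.

Let HS_lb K L : lbound (HS K L) 0.
Proof. by move=> e [/ltW]. Qed.

Let HS_inf K L : has_inf (HS K L).
Proof. by split; [exact: HS_neq0|exists 0; exact: HS_lb]. Qed.

Let hausdorff_dist_ge0 K L : 0 <= hausdorff_dist K L.
Proof. by apply: lb_le_inf; [exact: HS_neq0|exact: HS_lb]. Qed.

Let hausdorff_distxx K : hausdorff_dist K K = 0.
Proof.
apply/eqP; rewrite eq_le hausdorff_dist_ge0 andbT; apply/ler_addgt0Pl => e e0.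
rewrite addr0; apply: ge_inf; first by exists 0; exact: HS_lb.
by split => // x Kx; exists x => //; rewrite mdistxx.
Qed.

Let hausdorff_dist_sym K L : hausdorff_dist K L = hausdorff_dist L K.
Proof.
by congr inf; apply/seteqP; split => e [e0 KL LK]; split.
Qed.

Let hausdorff_dist0_sub K L : hausdorff_dist K L = 0 -> K `<=` L.
Proof.
move=> KL0 x Kx; apply: (@csub_closed L) => A /nbhs_ballP[e /= e0 eA].
have [d [_ Kd _] dlt] := inf_adherent e0 (HS_inf K L).
move: dlt; rewrite -/(hausdorff_dist K L) KL0 add0r => de.
have [y Ly xy] := Kd x Kx; exists y; split => //; apply: eA.
by rewrite ballEmdist/=; exact: lt_trans de.
Qed.

Let hausdorff_dist_positivity K L : hausdorff_dist K L = 0 -> K = L.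
Proof.
move=> KL0; apply: csub_inj; apply/seteqP; split; apply: hausdorff_dist0_sub => //.
by rewrite hausdorff_dist_sym.
Qed.

Let thickening_trans (A B C : set X) d e : A `<=` thickening d B ->
  B `<=` thickening e C -> A `<=` thickening (d + e) C.
Proof.
move=> AB BC x /AB[y /BC[z Cz yz] xy]; exists z => //.
by rewrite (le_lt_trans (metric_triangle _ y _))// ltrD.
Qed.

Let hausdorff_dist_triangle L K M :
  hausdorff_dist K M <= hausdorff_dist K L + hausdorff_dist L M.
Proof.
apply/ler_addgt0Pl => e e0.
have e20 : 0 < e / 2 by rewrite divr_gt0.
have [d1 [d10 KL LK] d1lt] := inf_adherent e20 (HS_inf K L).
have [d2 [d20 LM ML] d2lt] := inf_adherent e20 (HS_inf L M).
apply: (@le_trans _ _ (d1 + d2)); last first.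
  by rewrite [leRHS]addrC [e]splitr addrACA; apply/ltW; exact: ltrD d1lt d2lt.
apply: ge_inf; first by exists 0; exact: HS_lb.
split; first exact: addr_gt0.
- exact: thickening_trans KL LM.
- by rewrite addrC; exact: thickening_trans ML LK.
Qed.

(* The Hausdorff metric. *)
HB.instance Definition _ := isMetric.Build R closedSubgroup hausdorff_distxx
  hausdorff_dist_positivity hausdorff_dist_sym hausdorff_dist_triangle.

HB.instance Definition _ := isPointed.Build closedSubgroup full_subgroup.

End closedSubgroup.

Arguments full_subgroup {R} X.

Section Haar.
Variables (R : realType) (X : compactMetricGroupType R).

Definition haar (m : Prob R X) : Prop :=
  forall (x : X) (A : set (borel X)), measurable A ->
    m ((fun y : X => (x * y)%g) @^-1` A) = m A.

End Haar.

Definition free_ultrafilter (omega : set_system nat) : Prop :=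
  UltraFilter omega /\ \bigcap_(A in omega) A = set0.

(* In the library, permutations act on the right, [(p * q)%g j = q (p j)]; hence
   [(sigma k h * sigma k g)%g] is the composition of sigma_k(g) after
   sigma_k(h). *)
Definition sofic_approximation (R : realType) (G : groupType) (d : nat -> nat)
    (sigma : forall k, G -> 'S_(d k)) : Prop :=
  [/\ d @ \oo --> \oo,
      forall g h : G, (fun k => hamming R (sigma k (g * h)%g)
        (sigma k h * sigma k g)%g) @ \oo --> (0 : R) &
      forall g h : G, g <> h ->
        (fun k => hamming R (sigma k g) (sigma k h)) @ \oo --> (1 : R)].

Record algebraic_action (G : groupType) (R : realType)
    (X : compactMetricGroupType R) (a : G -> X -> X) : Prop := {
  action1 : forall x, a 1%g x = x;
  actionM : forall g h x, a (g * h)%g x = a g (a h x);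
  action_morph : forall g, {morph a g : x y / (x * y)%g};
  action_continuous : forall g, continuous (a g)
}.

Section Microstates.
Variables (R : realType) (G : groupType) (X : compactMetricGroupType R).
Variables (a : G -> X -> X) (d : nat -> nat).
Variables (sigma : forall k, G -> 'S_(d k)) (omega : set_system nat).

Definition diag_nbhs (U : set (X * X)) : Prop := forall x : X, nbhs (x, x) U.

(* [U] is Borel, so that the event is measurable. *)
Definition asymptotically_supported
    (mu : forall k, Prob R {ptws 'I_(d k) -> X}) : Prop :=
  forall (g : G) (delta : R) (U : set (X * X)),
    0 < delta -> <<s @open (X * X)%type >> U -> diag_nbhs U ->
    (fun k => mu k [set phi | 1 - delta <=
       unif R [set j | U (phi (sigma k g j), a g (phi j))]])
      @ omega --> (1%E : \bar R).

Definition locally_weak_star_cvg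
    (mu : forall k, Prob R {ptws 'I_(d k) -> X}) (m : Prob R X) : Prop :=
  forall O : set (Prob R X), nbhs m O ->
    (fun k => unif R [set j | O (marginal (mu k) j)]) @ omega --> (1 : R).

Definition topological_microstates
    (phi : forall k, {ptws 'I_(d k) -> X}) : Prop :=
  forall (g : G) (U : set (X * X)), diag_nbhs U ->
    (fun k => unif R [set j | U (a g (phi k j), phi k (sigma k g j))])
      @ omega --> (1 : R).

Definition absorbs (Y : forall k, 'I_(d k) -> closedSubgroup X) : Prop :=
  forall phi : forall k, {ptws 'I_(d k) -> X}, topological_microstates phi ->
  forall e : R, 0 < e ->
    (fun k => unif R [set j | setdist (phi k j) (Y k j) < e])
      @ omega --> (1 : R).

End Microstates.

(* Main.v *)
Require Import Defs.
From HB Require Import structures.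
From mathcomp Require Import all_boot all_order all_algebra all_fingroup.
From mathcomp Require Import all_classical all_reals all_analysis.
From mathcomp Require Import measurable_realfun ring lra.

(* Microstate sequences form a group under pointwise multiplication.  A packing
   argument gives, for each scale [1/n], a finite family of microstate sequences
   whose values at most coordinates [j] absorb, up to [1/n], the values of every
   other finite family.  Absorbing its own quotients, this set of values is an
   approximate subgroup of [X], hence close to a closed subgroup, and a diagonal
   choice of the scale along [omega] gives absorbing subgroups [Y_k(j)].  If
   these converge to [X], the random words of a suitable length in the finite
   families are again microstates, and their marginal at [j] is nearly Haar
   because at most coordinates the letters are dense in [X].
   Conversely, a subgroup that is far from [X] has a neighbourhood of Haar
   measure at most [1/2], whereas measures supported on microstates charge the
   neighbourhoods of absorbing subgroups almost fully. *)

Set Implicit Arguments.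
Unset Strict Implicit.
Unset Printing Implicit Defensive.

Import Order.TTheory GRing.Theory Num.Theory.
Import numFieldNormedType.Exports.

Local Open Scope classical_set_scope.
Local Open Scope ring_scope.

(** * Free ultrafilters and uniform measures *)

(** There are uncountably many microstate sequences, and each is absorbed on its own [omega]-large
    set, so a diagonal choice cannot treat them one by one. It only arranges countably many demands,
    among them that the family of scale [m k] covers all earlier families. An arbitrary sequence is
    absorbed through an intermediary: a family of fixed scale covers it and is itself covered by the
    family of scale [m k]. The length of the words must be chosen before [k] and the coordinate [j]
    are known. This is possible because one more letter contracts oscillations by a factor that
    depends only on the number of letters, so one length serves every coordinate at which the
    letters are dense enough. In the converse direction the subgroup varies with the coordinate,
    whereas local weak-star convergence speaks of one neighbourhood of the Haar measure at a time; a
    finite partition of [X] reduces the thickenings of all closed subgroups to finitely many test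
    functions. *)

Section FreeUltrafilter.
Variables (omega : set_system nat) (omega_free : free_ultrafilter omega).
Let ultra_omega : UltraFilter omega := omega_free.1.
Local Existing Instance ultra_omega.

Lemma ultra_not (A : set nat) : ~ omega A -> omega (~` A).
Proof. by move=> nA; have [|//] := in_ultra_setVsetC A ultra_omega. Qed.

Lemma ultra_nempty (A : set nat) : omega A -> exists k, A k.
Proof. exact: filter_ex. Qed.

Lemma ultra_all_seq (T : eqType) (s : seq T) (B : T -> set nat) :
  (forall t, t \in s -> omega (B t)) ->
  omega [set k | forall t, t \in s -> B t k].
Proof.
elim: s => [_|t s IHs wB]; first by apply: filterS filterT => k _ t.
have wBs : omega [set k | forall t, t \in s -> B t k].
  by apply: IHs => u us; apply: wB; rewrite inE us orbT.
apply: filterS2 (wB t (mem_head _ _)) wBs => k Btk Bk u.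
by rewrite inE => /predU1P[->|/Bk].
Qed.

Lemma ultra_all_le n (B : nat -> set nat) : (forall i, omega (B i)) ->
  omega [set k | forall i, (i <= n)%N -> B i k].
Proof.
move=> wB; apply: filterS (ultra_all_seq (s := iota 0 n.+1) (fun i _ => wB i)).
by move=> k Bk i i_n; apply: Bk; rewrite mem_iota.
Qed.

Lemma free_ultra_ge (n : nat) : omega [set k | (n <= k)%N].
Proof.
elim: n => [|n IHn]; first exact: filterS filterT.
have : omega (~` [set n]).
  apply: ultra_not => wn; have [_ cap0] := omega_free.
  suff : (\bigcap_(A in omega) A) n by rewrite cap0.
  move=> A wA; have [k [/= -> //]] := ultra_nempty (filterI wn wA).
apply: filterS2 IHn => k /= nk kn; rewrite ltn_neqAle nk andbT.
by apply/eqP => nk'; apply: kn.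
Qed.

Lemma free_ultra_inv (R : realType) (e : R) : 0 < e ->
  omega [set k | k.+1%:R^-1 < e].
Proof.
move=> e0; apply: filterS (free_ultra_ge (Num.truncn e^-1)) => k /= ek.
rewrite invf_plt ?posrE//; apply: lt_le_trans (truncnS_gt _) _.
by rewrite ler_nat ltnS.
Qed.

(** [m k] is the largest index up to [k] for which this and all earlier conditions hold at [k]. The
    cap [k] makes the maximum exist and is harmless because [omega] is free. *)
Lemma diagonal_index (A : nat -> set nat) : (forall n, omega (A n)) ->
  exists m : nat -> nat, forall n, omega [set k | (n <= m k)%N /\ A (m k) k].
Proof.
move=> wA.
pose P k n := `[< forall i, (i <= n)%N -> A i k >].
exists (fun k => \max_(i < k.+1 | P k i) i) => n.
have wB : omega [set k | forall i, (i <= n)%N -> A i k].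
  exact: ultra_all_le.
apply: filterS2 wB (free_ultra_ge n) => k /= Bk nk.
have Pn : P k (inord n : 'I_k.+1) by rewrite inordK//; apply/asboolP.
split.
  have En : (inord n : 'I_k.+1) = n :> nat by rewrite inordK.
  by rewrite -[leqLHS]En; apply: (@leq_bigmax_cond _ _ _ (inord n)).
rewrite (bigop.bigmax_eq_arg (inord n))//.
by case: arg_maxnP => // i /asboolP Pi _; exact: Pi.
Qed.

End FreeUltrafilter.

Section UniformMeasure.
Variable R : realType.

Lemma unif_ge0 n (A : set 'I_n) : 0 <= unif R A.
Proof. by rewrite divr_ge0. Qed.

Lemma le_unif n (A B : set 'I_n) : A `<=` B -> unif R A <= unif R B.
Proof.
move=> AB; rewrite ler_wpM2r ?invr_ge0// ler_nat; apply/subset_leq_card.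
apply/fintype.subsetP => j.
by rewrite -!topredE/= => /asboolP/AB ?; apply/asboolP.
Qed.

Lemma unif_sum n (A : set 'I_n) : unif R A = (\sum_j `[< A j >]%:R) / n%:R.
Proof.
rewrite /unif -sum1_card natr_sum big_mkcond/=; congr (_ / _).
by apply: eq_bigr => j _; rewrite -topredE/=; case: ifP.
Qed.

Lemma unifU n (A B : set 'I_n) : unif R (A `|` B) <= unif R A + unif R B.
Proof.
rewrite !unif_sum -mulrDl ler_wpM2r ?invr_ge0// -big_split/=.
apply: ler_sum => j _; rewrite -natrD ler_nat.
case: asboolP => // -[Aj|Bj]; first by rewrite (asboolT Aj).
by rewrite (asboolT Bj) addn1.
Qed.

Lemma unifC n (A : set 'I_n) : (0 < n)%N -> unif R (~` A) = 1 - unif R A.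
Proof.
move=> n0; apply/eqP; rewrite -subr_eq opprK !unif_sum -mulrDl -big_split/=.
rewrite (eq_bigr (fun=> 1)) => [|j _]; last first.
  by rewrite asbool_neg; case: asboolP; rewrite ?addr0 ?add0r.
by rewrite sumr_const card_ord divff// pnatr_eq0 -lt0n.
Qed.

Lemma unif_le1 n (A : set 'I_n) : (0 < n)%N -> unif R A <= 1.
Proof. by move=> n0; rewrite -subr_ge0 -unifC// unif_ge0. Qed.

End UniformMeasure.

(** * Properties that hold at asymptotically all coordinates *)

Section Most.
Variables (R : realType) (d : nat -> nat) (d_gt0 : forall k, (0 < d k)%N).
Variables (omega : set_system nat) (omega_free : free_ultrafilter omega).
Let ultra_omega : UltraFilter omega := omega_free.1.
Local Existing Instance ultra_omega.

(** Stated through complements, so that intersections become union bounds; [mostP] gives the form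
    with limit 1. *)
Definition most (A : forall k, set 'I_(d k)) :=
  forall e : R, 0 < e -> omega [set k | unif R (~` A k) <= e].

Lemma mostP (A : forall k, set 'I_(d k)) :
  ((fun k => unif R (A k)) @ omega --> (1 : R)) <-> most A.
Proof.
split=> [/cvgrPdist_le cA e e0|mA].
  apply: filterS (cA e e0) => k /=.
  by rewrite unifC// ger0_norm// subr_ge0 unif_le1.
apply/cvgrPdist_le => e e0; apply: filterS (mA e e0) => k /=.
by rewrite unifC// ger0_norm// subr_ge0 unif_le1.
Qed.

Lemma mostS (A B : forall k, set 'I_(d k)) :
  (forall k, A k `<=` B k) -> most A -> most B.
Proof.
move=> AB mA e e0; apply: filterS (mA e e0) => k; apply: le_trans.
by apply: le_unif; apply: subsetC.
Qed.

Lemma mostI (A B : forall k, set 'I_(d k)) :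
  most A -> most B -> most (fun k => A k `&` B k).
Proof.
move=> mA mB e e0; have e20 : 0 < e / 2 by rewrite divr_gt0.
apply: filterS2 (mA _ e20) (mB _ e20) => k /= Ak Bk.
by rewrite setCI (le_trans (unifU _ _ _))// [e]splitr lerD.
Qed.

Lemma mostT : most (fun k => setT).
Proof.
move=> e e0; apply: filterS filterT => k _ /=.
by rewrite unifC// unif_sum (eq_bigr (fun=> 1)) ?sumr_const ?card_ord
  ?divff ?subrr ?ltW// ?pnatr_eq0 -?lt0n// => j _; rewrite asboolT.
Qed.

Lemma most_near (A : forall k, set 'I_(d k)) :
  omega [set k | A k = setT] -> most A.
Proof.
move=> wA e e0; apply: filterS2 wA (mostT e0) => k /= ->; exact.
Qed.

End Most.

(** * Ultralimits in a compact metric group *)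

(** Compactness enters as existence of ultralimits, because the lemma serves both [X] and the space
    of closed subgroups, whose compactness is proved in exactly this form. *)
Lemma ultra_continuous_bounded (R : realType) (T : topologicalType)
    (omega : set_system nat) (omega_free : free_ultrafilter omega) :
  (forall u : nat -> T, exists x : T, u @ omega --> x) ->
  forall f : T -> R, continuous f ->
  exists M : R, forall x, `|f x| <= M.
Proof.
move=> limT f cf; have ultra_omega := omega_free.1.
apply/not_notP => nM.
have /choice[K nK] : forall n, exists K : T, n.+1%:R < `|f K|.
  move=> n; apply/not_notP => nK; apply: nM; exists n.+1%:R => // K.
  by rewrite leNgt; apply/negP => nfK; apply: nK; exists K.
have [L KL] := limT K.
have /cvgrPdist_lt/(_ _ ltr01) : f \o K @ omega --> f L.
  exact: cvg_comp KL (cf L).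
move=> /(filterI (free_ultra_ge omega_free (Num.truncn (`|f L| + 1)))).
move=> /(ultra_nempty omega_free)[n /= [nL fLn]].
have : `|f L| + 1 < n.+1%:R.
  by apply: lt_le_trans (truncnS_gt _) _; rewrite ler_nat ltnS.
move=> nfL; have := lt_trans nfL (nK n); apply/negP; rewrite -leNgt.
rewrite -lerBlDl (le_trans (lerB_dist _ _))// distrC.
exact: ltW.
Qed.

Section CompactMetricGroup.
Variables (R : realType) (X : compactMetricGroupType R).
Variables (omega : set_system nat) (omega_free : free_ultrafilter omega).
Let ultra_omega : UltraFilter omega := omega_free.1.
Local Existing Instance ultra_omega.

Lemma ultra_lim (u : nat -> X) : exists x : X, u @ omega --> x.
Proof.
have [x [_ ux]] : [set: X] `&` cluster (u @ omega) !=set0.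
  by apply: group_compact; exact: filterT.
exists x => A Ax; apply/not_notP => /(ultra_not omega_free) uA.
by have [y []] := ux (~` A) A uA Ax.
Qed.

Lemma cvg_mdist (u : nat -> X) (x : X) : u @ omega --> x ->
  forall e, 0 < e -> omega [set n | mdist x (u n) < e].
Proof.
move=> ux e e0; have /cvg_ballP/(_ _ e0) := ux.
by apply: filterS => n; rewrite ballEmdist.
Qed.

Lemma cvg_mdist_close (u v : nat -> X) (x : X) : u @ omega --> x ->
  (forall n, mdist (u n) (v n) < n.+1%:R^-1) -> v @ omega --> x.
Proof.
move=> ux uv; apply/cvg_ballP => e e0; have e20 : 0 < e / 2 by rewrite divr_gt0.
have we2 := free_ultra_inv omega_free e20.
apply: filterS2 (cvg_mdist ux e20) we2 => n /= xu ne.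
rewrite ballEmdist/= (le_lt_trans (metric_triangle _ (u n) _))// [e]splitr.
by rewrite ltrD// (lt_trans (uv n)).
Qed.

(** A Lebesgue number for the diagonal: pairs outside [U] at distance tending to 0 would have an
    ultralimit on the diagonal. The given [omega] replaces the extraction of subsequences here and
    in the next compactness arguments. *)
Lemma diag_nbhs_mdist (U : set (X * X)) : diag_nbhs U ->
  exists2 e : R, 0 < e & forall x y, mdist x y < e -> U (x, y).
Proof.
move=> dU; apply/not_notP => nU.
have /choice[p np] : forall n, exists p : X * X,
    mdist p.1 p.2 < n.+1%:R^-1 /\ ~ U p.
  move=> n; apply/not_notP => np; apply: nU; exists n.+1%:R^-1 => // x y xy.
  by apply/not_notP => nUxy; apply: np; exists (x, y).
have [x ux] := ultra_lim (fst \o p).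
have vx : (snd \o p) @ omega --> x.
  by apply: cvg_mdist_close ux _ => n; case: (np n).
have [n Un] := ultra_nempty omega_free (cvg_pair ux vx (dU x)).
by have [_] := np n; apply; move: Un; rewrite /= -surjective_pairing.
Qed.

Lemma continuous_heine (f : X -> R) : continuous f -> forall e : R, 0 < e ->
  exists2 r : R, 0 < r & forall x y, mdist x y < r -> `|f x - f y| < e.
Proof.
move=> cf e e0.
apply: (@diag_nbhs_mdist [set p | `|f p.1 - f p.2| < e]) => x.
have cff : {for (x, x), continuous (fun p : X * X => f p.1 - f p.2)}.
  apply: (@cvgB _ _ (X * X)%type); apply: continuous_comp (cf _).
    exact: cvg_fst.
  exact: cvg_snd.
have /cvgr0Pnorm_lt : (fun p : X * X => f p.1 - f p.2) @ (x, x) --> (0 : R).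
  by rewrite -[X in _ --> X](subrr (f x)); exact: cff.
exact.
Qed.

Lemma continuous2_heine (f : X -> X -> X) :
  continuous (fun p : X * X => f p.1 p.2) -> forall e : R, 0 < e ->
  exists2 r : R, 0 < r & forall x x' y y',
    mdist x x' < r -> mdist y y' < r -> mdist (f x y) (f x' y') < e.
Proof.
move=> cf e e0; apply/not_notP => nf.
have /choice[p np] : forall n, exists p : (X * X) * (X * X),
    [/\ mdist p.1.1 p.1.2 < n.+1%:R^-1, mdist p.2.1 p.2.2 < n.+1%:R^-1 &
    ~ mdist (f p.1.1 p.2.1) (f p.1.2 p.2.2) < e].
  move=> n; apply/not_notP => np; apply: nf; exists n.+1%:R^-1 => //.
  move=> x x' y y' xx' yy'.
  by apply/not_notP => nUxy; apply: np; exists ((x, x'), (y, y')).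
have [x ux] := ultra_lim (fun n => (p n).1.1).
have [y uy] := ultra_lim (fun n => (p n).2.1).
have vx : (fun n => (p n).1.2) @ omega --> x.
  by apply: cvg_mdist_close ux _ => n; case: (np n).
have vy : (fun n => (p n).2.2) @ omega --> y.
  by apply: cvg_mdist_close uy _ => n; case: (np n).
have e20 : 0 < e / 2 by rewrite divr_gt0.
have FF : Filter omega by exact: _.
have Hu := cvg_mdist (continuous2_cvg FF (cf (x, y)) ux uy) e20.
have Hv := cvg_mdist (continuous2_cvg FF (cf (x, y)) vx vy) e20.
have [n [/= un vn]] := ultra_nempty omega_free (filterI Hu Hv).
have [_ _] := np n; apply.
rewrite (le_lt_trans (metric_triangle _ (f x y) _))// [e]splitr.
by rewrite ltrD// metric_sym.
Qed.

Lemma divg_continuous : continuous (fun p : X * X => p.1 * p.2^-1)%g.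
Proof.
move=> p; apply: (@continuous_comp _ _ _ (fun p : X * X => (p.1, p.2^-1)%g)
  (fun p : X * X => p.1 * p.2)%g); last exact: mulg_continuous.
apply: cvg_pair; first exact: cvg_fst.
by apply: continuous_comp; [exact: cvg_snd|exact: invg_continuous].
Qed.

(** The uniformity in both outer factors is what random words require: a letter stands between the
    rest of the word and the starting point. *)
Lemma continuous_mul_heine (f : X -> R) : continuous f -> forall e : R, 0 < e ->
  exists2 r : R, 0 < r & forall t s s' x,
    mdist s s' < r -> `|f (t * s * x)%g - f (t * s' * x)%g| <= e.
Proof.
move=> cf e e0; have [r1 r10 fr] := continuous_heine cf e0.
have [r2 r20 mr2] := continuous2_heine mulg_continuous r10.
have [r3 r30 mr3] := continuous2_heine mulg_continuous r20.
exists r3 => // t s s' x ss'; apply/ltW/fr/mr2; rewrite ?mdistxx//.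
by apply/mr3; rewrite ?mdistxx.
Qed.

(** The limit of [W n] along [omega] in the Hausdorff sense; for nonempty sets it consists of the
    ultralimits of sequences chosen from [W n]. *)
Definition set_lim (W : nat -> set X) : set X :=
  [set x | forall e, 0 < e -> omega [set n | thickening e (W n) x]].

Lemma set_lim_closed (W : nat -> set X) : closed (set_lim W).
Proof.
move=> x xW e e0; have e20 : 0 < e / 2 by rewrite divr_gt0.
have [y [yW]] := xW _ (nbhsx_ballx x _ e20); rewrite ballEmdist/= => xy.
apply: filterS (yW _ e20) => n [z Wz yz]; exists z => //.
by rewrite (le_lt_trans (metric_triangle _ y _))// [e]splitr ltrD.
Qed.

(** Points of [W n] that violate the inclusion would have an ultralimit in [set_lim W], to which
    they come arbitrarily close. *)
Lemma sub_set_lim (W : nat -> set X) (e : R) : 0 < e ->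
  omega [set n | W n `<=` thickening e (set_lim W)].
Proof.
move=> e0; apply/not_notP => /(ultra_not omega_free) nW.
have /choice[u uP] : forall n, exists x : X,
    ~ (W n `<=` thickening e (set_lim W)) ->
    W n x /\ ~ thickening e (set_lim W) x.
  move=> n; have [Wn|] := pselect (W n `<=` thickening e (set_lim W)).
    by exists point => /(_ Wn).
  by move=> /existsNP[x /not_implyP xP]; exists x.
have [x ux] := ultra_lim u.
have xW : set_lim W x.
  move=> e' e'0; apply: filterS2 nW (cvg_mdist ux e'0) => n /= /uP[Wn _] xu.
  by exists (u n).
have [n [/= /uP[_ nun] xun]] :=
  ultra_nempty omega_free (filterI nW (cvg_mdist ux e0)).
by apply: nun; exists x => //; rewrite metric_sym.
Qed.

Lemma set_lim_sub (W : nat -> set X) (e : R) : 0 < e ->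
  omega [set n | set_lim W `<=` thickening e (W n)].
Proof.
move=> e0; apply/not_notP => /(ultra_not omega_free) nW.
have /choice[u uP] : forall n, exists x : X,
    ~ (set_lim W `<=` thickening e (W n)) ->
    set_lim W x /\ ~ thickening e (W n) x.
  move=> n; have [Wn|] := pselect (set_lim W `<=` thickening e (W n)).
    by exists point => /(_ Wn).
  by move=> /existsNP[x /not_implyP xP]; exists x.
have [x ux] := ultra_lim u.
have e20 : 0 < e / 2 by rewrite divr_gt0.
have xW : set_lim W x.
  apply: set_lim_closed => A xA; have uA : omega (u @^-1` A) by exact: ux.
  have [n [/= /uP[un _] Aun]] := ultra_nempty omega_free (filterI nW uA).
  by exists (u n).
have [n [[/= /uP[_ nun] xun] [y Wy xy]]] :=
  ultra_nempty omega_free (filterI (filterI nW (cvg_mdist ux e20)) (xW _ e20)).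
apply: nun; exists y => //; rewrite (le_lt_trans (metric_triangle _ x _))//.
by rewrite [e]splitr ltrD// metric_sym.
Qed.

Lemma set_lim_neq0 (W : nat -> set X) : (forall n, W n !=set0) ->
  set_lim W !=set0.
Proof.
move=> W0; have [n Wn] := ultra_nempty omega_free (sub_set_lim W ltr01).
by have [x /Wn[y yW _]] := W0 n; exists y.
Qed.

Lemma set_lim_div (W : nat -> set X) :
  (forall n x y, W n x -> W n y ->
    thickening n.+1%:R^-1 (W n) (x * y^-1)%g) ->
  forall x y, set_lim W x -> set_lim W y -> set_lim W (x * y^-1)%g.
Proof.
move=> WV x y xW yW e e0; have e20 : 0 < e / 2 by rewrite divr_gt0.
have [r r0 divr] :=
  @continuous2_heine (fun x y => x * y^-1)%g divg_continuous _ e20.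
apply: filterS3 (xW _ r0) (yW _ r0) (free_ultra_inv omega_free e20).
move=> n [x' Wx' xx'] [y' Wy' yy'] ne; have [z Wz z'] := WV n _ _ Wx' Wy'.
exists z => //; rewrite (le_lt_trans (metric_triangle _ (x' * y'^-1)%g _))//.
by rewrite [e]splitr ltrD// ?divr// (lt_trans z').
Qed.

Lemma closed_div_subgroup (K : set X) : closed K -> K !=set0 ->
  (forall x y, K x -> K y -> K (x * y^-1)%g) ->
  exists L : closedSubgroup X, L = K :> set X.
Proof.
move=> cK [x Kx] KV.
have K1 : K 1%g by rewrite -(mulgV x); exact: KV.
have KI y : K y -> K y^-1%g by move=> Ky; rewrite -(mul1g y^-1%g); exact: KV.
have KM y z : K y -> K z -> K (y * z)%g.
  by move=> Ky /KI Kz; rewrite -(invgK z); exact: KV.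
by exists (ClosedSubgroup cK K1 KM KI).
Qed.

(** Compactness gives [e] without an explicit value: the limit of counterexamples with [e] tending
    to 0 is closed under division, hence a closed subgroup, and it is [eta]-close to one of them. *)
Lemma approximate_subgroup (eta : R) : 0 < eta -> exists2 e : R, 0 < e &
  forall W : set X, W !=set0 ->
    (forall x y, W x -> W y -> thickening e W (x * y^-1)%g) ->
  exists K : closedSubgroup X,
    W `<=` thickening eta K /\ K `<=` thickening eta W.
Proof.
move=> eta0; apply/not_notP => nK.
have /choice[W nW] : forall n, exists W : set X, [/\ W !=set0,
    forall x y, W x -> W y -> thickening n.+1%:R^-1 W (x * y^-1)%g &
    ~ exists K : closedSubgroup X,
      W `<=` thickening eta K /\ K `<=` thickening eta W].
  move=> n; apply/not_notP => nW; apply: nK; exists n.+1%:R^-1 => // W W0 WV.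
  by apply/not_notP => nKW; apply: nW; exists W.
have [K KW] : exists K : closedSubgroup X, K = set_lim W :> set X.
  apply: closed_div_subgroup; first exact: set_lim_closed.
    by apply: set_lim_neq0 => n; case: (nW n).
  by apply: set_lim_div => n; case: (nW n).
have [n [Wn KWn]] :=
  ultra_nempty omega_free (filterI (sub_set_lim W eta0) (set_lim_sub W eta0)).
by have [_ _] := nW n; apply; exists K; rewrite KW.
Qed.

Lemma mdist_csub_lt (K L : closedSubgroup X) (e : R) : mdist K L < e ->
  K `<=` thickening e L /\ L `<=` thickening e K.
Proof.
move=> KLe; have e0 : 0 < e by rewrite (le_lt_trans _ KLe)// mdist_ge0.
pose HS := [set r : R | [/\ 0 < r, K `<=` thickening r L &
  L `<=` thickening r K]].
have KLE : mdist K L = inf HS by [].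
(* The infimum of the empty set is 0 by convention; in that case the distance vanishes and
   [K = L]. *)
have [HS0|/set0P HS0] := eqVneq HS set0.
  have -> : K = L by apply: mdist_positivity; rewrite KLE HS0 inf0.
  by split=> x Lx; exists x; rewrite ?mdistxx.
have HSi : has_inf HS by split => //; exists 0 => r [/ltW].
have eKL : 0 < e - mdist K L by rewrite subr_gt0.
have [r [_ KL LK]] := inf_adherent eKL HSi; rewrite -KLE addrC subrK => re.
by split=> x => [/KL|/LK] [y Ly xy]; exists y => //; exact: lt_trans re.
Qed.

Lemma mdist_csub_le (K L : closedSubgroup X) (e : R) : 0 < e ->
  K `<=` thickening e L -> L `<=` thickening e K -> mdist K L <= e.
Proof. by move=> e0 KL LK; apply: ge_inf => //; exists 0 => r [/ltW]. Qed.

Lemma mdist_full_lt (K : closedSubgroup X) (e : R) :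
  mdist K (full_subgroup X) < e -> forall x, thickening e K x.
Proof. by move=> /mdist_csub_lt[_ KX] x; exact: KX. Qed.

Lemma mdist_full_le (K : closedSubgroup X) (e : R) : 0 < e ->
  (forall x, thickening e K x) -> mdist K (full_subgroup X) <= e.
Proof.
by move=> e0 KX; apply: mdist_csub_le => // x _; exists x; rewrite ?mdistxx.
Qed.

(** Compactness of the Hausdorff topology on closed subgroups, in ultralimit form. *)
Lemma csub_ultra_lim (K : nat -> closedSubgroup X) :
  exists L : closedSubgroup X, K @ omega --> L.
Proof.
have [L LK] : exists L : closedSubgroup X, L = set_lim K :> set X.
  apply: closed_div_subgroup; first exact: set_lim_closed.
    by apply: set_lim_neq0 => n; exists 1%g; exact: csub_1.
  apply: set_lim_div => n x y Kx Ky.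
  exists (x * y^-1)%g; rewrite ?mdistxx ?invr_gt0//.
  by apply: csub_M => //; exact: csub_V.
exists L; apply/cvg_ballP => e e0; have e20 : 0 < e / 2 by rewrite divr_gt0.
apply: filterS2 (sub_set_lim K e20) (set_lim_sub K e20) => n /= Kn nK.
rewrite ballEmdist/= (@le_lt_trans _ _ (e / 2))//; last first.
  by rewrite ltr_pdivrMr// ltr_pMr// ltr1n.
by apply: mdist_csub_le; rewrite ?LK.
Qed.

End CompactMetricGroup.

(** * The weak* topology *)

Lemma cvg_initial (S : choiceType) (T : topologicalType) (f : S -> T)
    (F : set_system S) (s : S) : Filter F ->
  f @ F --> f s -> F --> (s : initial_topology f).
Proof.
move=> FF fF O [_ [[B oB <-] Bs] BO]; apply: filterS BO _.
by apply: fF; exact: open_nbhs_nbhs.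
Qed.

Lemma ptws_cvgP (I : Type) (T : topologicalType) (F : set_system (I -> T))
    (f : {ptws I -> T}) : Filter F ->
  F --> f <-> (forall i, (fun g : I -> T => g i) @ F --> f i).
Proof.
move=> FF; split=> [/cvg_sup Ff i|Ff].
  exact: cvg_trans (cvg_app _ (Ff i)) (@initial_continuous _ _ _ f).
by apply/cvg_sup => i; exact: cvg_initial (Ff i).
Qed.

Section WeakStarTopology.
Variables (R : realType) (T : ptopologicalType).

Lemma borel_continuous_measurable (f : T -> R) : continuous f ->
  measurable_fun setT (f : borel T -> R).
Proof.
move=> cf; apply: (measurability _ (RGenOpens.measurableE R)) => //.
move=> _ [_ [a [b ->]] <-]; rewrite setTI; apply: sub_sigma_algebra => /=.
by apply: open_comp; [move=> x _; exact: cf|exact: interval_open].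
Qed.

Lemma bounded_continuous_integrable (mu : Prob R T) (f : T -> R) :
  continuous f -> (exists M : R, forall x, `|f x| <= M) ->
  mu.-integrable setT (EFin \o (f : borel T -> R)).
Proof.
move=> cf [M fM]; apply: measurable_bounded_integrable => //.
- by rewrite (le_lt_trans (probability_le1 _ _))// ltry.
- exact: borel_continuous_measurable.
- exists M; split; rewrite ?num_real// => y My x _.
  exact: le_trans (fM x) (ltW My).
Qed.

(** A general filter is needed: besides images of [omega], the lemma is applied to the neighbourhood
    filter of [mX] and to the filter of sets that contain most marginals. *)
Lemma weak_star_cvgP (F : set_system (Prob R T)) (mu : Prob R T) :
  Filter F -> F --> mu <->
  (forall f : T -> R, continuous f ->
    (fun nu : Prob R T => \int[nu]_x (f x : R))%R @ F -->
      (\int[mu]_x (f x : R))%R).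
Proof.
move=> FF; split=> [Fmu f cf|Fmu].
  have IF : @integrals R T @ F --> @integrals R T mu.
    exact: cvg_comp Fmu (@initial_continuous _ _ (@integrals R T) mu).
  have IFf := (ptws_cvgP _ (fmap_filter _ FF)).1 IF (exist _ f cf).
  exact: IFf.
have IF : @integrals R T @ F --> @integrals R T mu.
  by apply/ptws_cvgP => -[f cf]; exact: Fmu.
exact: cvg_initial IF.
Qed.

Lemma integral_unif_pushforward n (n_gt0 : (0 < n)%N) (f : 'I_n -> T)
    (g : T -> R) : continuous g ->
  (\int[unif_pushforward R n_gt0 f]_x (g x : R))%R = (\sum_i g (f i)) / n%:R.
Proof.
move=> cg; have mg := borel_continuous_measurable cg.
have n0 : 0 <= (n%:R : R)^-1 by rewrite invr_ge0.
pose u k : T := if insub k is Some j then f j else point.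
have ge0E (h : borel T -> \bar R) : measurable_fun setT h ->
    (forall x, 0 <= h x)%E ->
    (\int[unif_pushforward R n_gt0 f]_x h x =
      (n%:R^-1)%R%:E * \sum_(i < n) h (f i))%E.
  move=> mh h0.
  pose m : {measure set (borel T) -> \bar R} :=
    mscale (NngNum n0) (msum (fun k => \d_(u k : borel T)) n).
  transitivity (\int[m]_x h x)%E.
    apply: eq_measure_integral => A _ _.
    by rewrite /unif_pushforward/= unif_imageE.
  rewrite ge0_integral_mscale// ge0_integral_measure_sum//.
  congr (_ * _)%E; apply: eq_bigr => i _.
  by rewrite integral_dirac// diracT mul1e /u valK.
(* [ge0E] requires a nonnegative integrand, so [g] is split into its positive and negative parts. *)
pose gp x := Num.max (g x) 0; pose gn x := Num.max (- g x) 0.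
have gpE : (fun x : borel T => (g x)%:E)^\+%E = EFin \o gp.
  by apply/funext => x; rewrite funeposE -EFin_max.
have gnE : (fun x : borel T => (g x)%:E)^\-%E = EFin \o gn.
  by apply/funext => x; rewrite funenegE -EFinN -EFin_max.
have mEg : measurable_fun setT (fun x : borel T => (g x)%:E).
  exact/measurable_EFinP.
rewrite /Rintegral integralE.
rewrite (ge0E _ (measurable_funepos mEg) (fun x => funepos_ge0 _ x)).
rewrite (ge0E _ (measurable_funeneg mEg) (fun x => funeneg_ge0 _ x)).
rewrite gpE gnE /= !sumEFin -!EFinM -EFinB/= -mulrBr mulrC -sumrB.
congr (_ / _); apply: eq_bigr => i _; rewrite /gp /gn.
by case: (leP (g _) 0) => g0; [rewrite max_l|rewrite max_r]; lra.
Qed.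

End WeakStarTopology.

(** * Microstate sequences *)

(** Total boundedness as a map to a finite type: the colours serve as pigeonholes in the packing
    argument and later encode subsets of [X] by finitely many boolean functions. *)
Lemma finite_coloring (R : realType) (X : compactMetricGroupType R) (e : R) :
  0 < e -> exists P (c : X -> 'I_P), forall x y, c x = c y -> mdist x y < e.
Proof.
move=> e0; have e20 : 0 < e / 2 by rewrite divr_gt0.
have := @group_compact X; rewrite compact_cover.
move=> /(_ X setT (fun x => (ball x (e / 2))°)).
case=> [x _|x _|D _ covD]; first exact: open_interior.
  by exists x => //; exact: nbhsx_ballx.
pose s : seq X := finmap.enum_fset D.
have /choice[c cP] : forall x, exists i : 'I_(size s),
    mdist (nth x s i) x < e / 2.
  move=> x; have [y /= yD /interior_subset] := covD x I.
  rewrite ballEmdist/= => yx.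
  have yDs : (index y s < size s)%N by rewrite index_mem.
  by exists (Ordinal yDs); rewrite nth_index.
exists (size s), c => x y cxy.
rewrite (le_lt_trans (metric_triangle _ (nth x s (c x)) _))// [e]splitr ltrD//.
  by rewrite metric_sym.
by rewrite (set_nth_default y) ?cxy.
Qed.

Section Microstates.
Variables (R : realType) (G : groupType) (X : compactMetricGroupType R).
Variables (a : G -> X -> X) (d : nat -> nat) (d_gt0 : forall k, (0 < d k)%N).
Variables (sigma : forall k, G -> 'S_(d k)).
Variables (omega : set_system nat) (omega_free : free_ultrafilter omega).
Hypothesis a_algebraic : algebraic_action a.
Let ultra_omega : UltraFilter omega := omega_free.1.
Local Existing Instance ultra_omega.

(** Named in order to carry classical equality, so that finite families can be lists with [\in]. *)
Definition mseq := forall k, {ptws 'I_(d k) -> X}.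

HB.instance Definition _ := gen_eqMixin mseq.
HB.instance Definition _ := gen_choiceMixin mseq.

Local Notation microstate := (topological_microstates a sigma omega).

Lemma microstateP (phi : mseq) : microstate phi <->
  forall (g : G) (e : R), 0 < e ->
  most R omega (fun k =>
    [set j | mdist (a g (phi k j)) (phi k (sigma k g j)) < e]).
Proof.
split=> [phiM g e e0|phiM g U /(diag_nbhs_mdist omega_free)[e e0 eU]].
  apply/(mostP _ d_gt0 omega_free).
  apply: (phiM g [set p | mdist p.1 p.2 < e]) => x.
  have e20 : 0 < e / 2 by rewrite divr_gt0.
  exists (ball x (e / 2), ball x (e / 2)); first by split; exact: nbhsx_ballx.
  move=> [y z] [/= xy xz]; move: (ball_sym xy) xz; rewrite !ballEmdist/=.
  move=> yx xz; rewrite (le_lt_trans (metric_triangle _ x _))//.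
  by rewrite [e]splitr ltrD.
apply/(mostP _ d_gt0 omega_free).
by apply: (mostS omega_free) (phiM g e e0) => k j; exact: eU.
Qed.

Lemma microstate_op (f : X -> X -> X) (phi psi : mseq) :
  continuous (fun p : X * X => f p.1 p.2) ->
  (forall g x y, a g (f x y) = f (a g x) (a g y)) ->
  microstate phi -> microstate psi ->
  microstate (fun k j => f (phi k j) (psi k j)).
Proof.
move=> cf af /microstateP phiM /microstateP psiM; apply/microstateP => g e e0.
have [r r0 fr] := continuous2_heine omega_free cf e0.
have pqM := mostI omega_free (phiM g r r0) (psiM g r r0).
apply: (mostS omega_free) pqM => k j [pj qj].
by rewrite /= af; exact: fr.
Qed.

Lemma action_mul (g : G) (x y : X) : a g (x * y)%g = (a g x * a g y)%g.
Proof. exact: (action_morph a_algebraic). Qed.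

Lemma action_one (g : G) : a g 1%g = 1%g.
Proof. by apply: (mulgI (a g 1%g)); rewrite -action_mul !mulg1. Qed.

Lemma action_inv (g : G) (x : X) : a g x^-1%g = (a g x)^-1%g.
Proof. by apply: (mulgI (a g x)); rewrite -action_mul !mulgV action_one. Qed.

Lemma microstate1 : microstate (fun k j => 1%g).
Proof.
apply/microstateP => g e e0.
apply: (mostS omega_free) (mostT d_gt0 omega_free) => k j _ /=.
by rewrite action_one mdistxx.
Qed.

Lemma microstateM (phi psi : mseq) : microstate phi -> microstate psi ->
  microstate (fun k j => (phi k j * psi k j)%g).
Proof.
apply: microstate_op; first exact: mulg_continuous.
by move=> g x y; exact: action_mul.
Qed.

Lemma microstate_div (phi psi : mseq) : microstate phi -> microstate psi ->
  microstate (fun k j => (phi k j * (psi k j)^-1)%g).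
Proof.
apply: (@microstate_op (fun x y => x * y^-1)%g); first exact: divg_continuous.
by move=> g x y; rewrite action_mul action_inv.
Qed.

Definition microstates (s : seq mseq) :=
  forall phi, phi \in s -> microstate phi.

Definition values (s : seq mseq) k (j : 'I_(d k)) : set X :=
  [set x | exists2 phi, phi \in s & x = phi k j].
Local Arguments values : clear implicits.

(* If every family [Phi] could be enlarged at a proportion [delta] of the
   coordinates, then after [N] enlargements some coordinate would carry
   [N * delta] points at mutual distance at least [e]. *)
Lemma microstates_saturated (e delta : R) : 0 < e -> 0 < delta ->
  exists2 Phi, microstates Phi & forall Psi, microstates Psi ->
    omega [set k | unif R (~` [set j |
      values Psi k j `<=` thickening e (values Phi k j)]) <= delta].
Proof.
move=> e0 delta0; apply/not_notP => nPhi.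
pose good Psi Phi k : set 'I_(d k) :=
  [set j | values Psi k j `<=` thickening e (values Phi k j)].
have /choice[next nextP] : forall Phi : seq mseq, exists Psi,
    microstates Phi -> microstates Psi /\
      omega [set k | delta < unif R (~` good Psi Phi k)].
  move=> Phi; apply/not_notP => nPsi; apply: nPhi; exists Phi.
    by apply/not_notP => nM; apply: nPsi; exists [::] => /nM.
  move=> Psi PsiM; apply/not_notP => nw; apply: nPsi.
  exists Psi => _; split=> //.
  apply: filterS (ultra_not omega_free nw) => k /=.
  by move=> /negP; rewrite -ltNge.
pose Phi := fix F n := if n is n'.+1 then F n' ++ next (F n') else [::].
have PhiM n : microstates (Phi n).
  elim: n => [//|n IHn] phi /=; rewrite mem_cat => /orP[/IHn//|].
  by have [+ _] := nextP _ IHn; apply.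
have Phi_sub k (j : 'I_(d k)) n m : (n <= m)%N ->
    values (Phi n) k j `<=` values (Phi m) k j.
  elim: m => [|m IHm]; first by rewrite leqn0 => /eqP ->.
  rewrite leq_eqVlt => /predU1P[-> //|/IHm nm] x /nm[phi phim ->].
  by exists phi => //=; rewrite mem_cat phim.
pose bad n k : set 'I_(d k) := ~` good (next (Phi n)) (Phi n) k.
have [P [c cP]] := finite_coloring X e0.
have few_bad N k (j : 'I_(d k)) :
    \sum_(n < N) `[< bad n k j >]%:R <= P%:R :> R.
  have /choice[x xP] : forall n, exists x, bad n k j ->
      values (next (Phi n)) k j x /\ ~ thickening e (values (Phi n) k j) x.
    move=> n; have [gn|] := pselect (good (next (Phi n)) (Phi n) k j).
      by exists point => /(_ gn).
    by move=> /existsNP[x /not_implyP xP]; exists x.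
  (* The uncovered point [x n] has joined the values of [Phi m], so an equal colour would put [x m]
     within [e] of a value already present. *)
  have far n m : (n < m)%N -> bad n k j -> bad m k j -> c (x n) <> c (x m).
    move=> nm /xP[[phi phin xn] _] /xP[_ xm] cnm; apply: xm.
    exists (x n); last exact/cP/esym.
    apply: (Phi_sub k j _ _ nm); exists phi => //=.
    by rewrite mem_cat phin orbT.
  rewrite (eq_bigr (fun n : 'I_N =>
      if n \in [pred n : 'I_N | `[< bad n k j >]] then 1 else 0)); last first.
    by move=> n _; rewrite -topredE/=; case: ifP.
  rewrite -big_mkcond sumr_const ler_nat -[leqRHS]card_ord.
  apply: (@leq_trans
    #|[seq c (x n) | n : 'I_N in [pred n : 'I_N | `[< bad n k j >]]]|).
    rewrite card_in_image// => n m.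
    rewrite -!topredE/= => /asboolP bn /asboolP bm cnm; apply/val_inj => /=.
    case: (ltngtP n m) => // nm; first by case: (far _ _ nm bn bm).
    by case: (far _ _ nm bm bn).
  exact: max_card.
(* Chosen so that [N * delta] exceeds [P]. Counting pairs of a stage and a bad coordinate in both
   orders, with [few_bad] for each coordinate, gives the opposite inequality. *)
pose N := (Num.truncn (P%:R / delta)).+1.
have wN : omega [set k | forall n, (n < N)%N -> delta < unif R (bad n k)].
  elim: N => [|N IHN]; first by apply: filterS filterT => k _ n.
  have [_ wN] := nextP _ (PhiM N).
  apply: filterS2 IHN wN => k Hk Nk n; rewrite ltnS leq_eqVlt.
  by move=> /predU1P[->|/Hk].
have [k Hk] := ultra_nempty omega_free wN.
have : N%:R * delta <= P%:R.
  apply: (@le_trans _ _ (\sum_(n < N) unif R (bad n k))).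
    rewrite mulr_natl -[N in _ *+ N]card_ord -sumr_const.
    by apply: ler_sum => n _; exact/ltW/Hk.
  under eq_bigr do rewrite unif_sum.
  rewrite -mulr_suml exchange_big/= ler_pdivrMr ?ltr0n//.
  apply: (@le_trans _ _ (\sum_(j < d k) P%:R)).
    by apply: ler_sum => j _; exact: few_bad.
  by rewrite sumr_const card_ord mulr_natr.
by rewrite leNgt -ltr_pdivrMr// truncnS_gt.
Qed.

End Microstates.

Arguments values {R X d} s k j.

(** * Random words and Haar measure *)

Section RandomWords.
Variables (R : realType) (X : compactMetricGroupType R).
Variables (omega : set_system nat) (omega_free : free_ultrafilter omega).

Fixpoint words (S : seq X) l : seq X :=
  if l is l'.+1 then [seq (w * s)%g | w <- words S l', s <- S] else [:: 1%g].

Lemma size_words (S : seq X) l : size (words S l) = (size S ^ l)%N.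
Proof. by elim: l => //= l IHl; rewrite size_allpairs IHl expnSr. Qed.

(** The [l]-th power of the Markov operator of the random walk with uniform steps from [S], acting
    by left multiplication. Words are listed with repetitions, so all choices of letters have equal
    weight. *)
Definition word_avg (S : seq X) (f : X -> R) l (x : X) : R :=
  (\sum_(w <- words S l) f (w * x)%g) / (size S ^ l)%:R.

Lemma word_avg0 (S : seq X) (f : X -> R) x : word_avg S f 0 x = f x.
Proof. by rewrite /word_avg/= big_seq1 mul1g expn0 divr1. Qed.

(** Splits off the letter next to [x], which turns the longer average at [x] into a mean of shorter
    averages at the points [s * x]; the induction on oscillations rests on this. *)
Lemma word_avgS (S : seq X) (f : X -> R) l x :
  word_avg S f l.+1 x = (\sum_(s <- S) word_avg S f l (s * x)%g) / (size S)%:R.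
Proof.
rewrite /word_avg -mulr_suml -mulrA -invfM -natrM -expnSr; congr (_ / _).
rewrite /= big_allpairs_dep exchange_big/=.
by apply: eq_bigr => s _; apply: eq_bigr => w _; rewrite mulgA.
Qed.

Lemma sum_seq_le (T : Type) (s : seq T) (F : T -> R) (M : R) :
  (forall t, F t <= M) -> \sum_(t <- s) F t <= (size s)%:R * M.
Proof.
move=> FM; elim: s => [|t s IHs]; first by rewrite big_nil mul0r.
by rewrite big_cons/= -natr1 mulrDl mul1r addrC lerD.
Qed.

Lemma sum_seq_sub (T : Type) (s : seq T) (F : T -> R) (z : R) :
  (0 < size s)%N ->
  (\sum_(t <- s) F t) / (size s)%:R - z =
  (\sum_(t <- s) (F t - z)) / (size s)%:R.
Proof.
move=> s0; rewrite sumrB mulrBl big_const_seq count_predT iter_addr addr0.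
by rewrite -(mulr_natr z) mulfK// pnatr_eq0 -lt0n.
Qed.

(** Averaging preserves the modulus [kappa] for every length, since the bound for [f] is uniform in
    the word on the left. *)
Lemma word_avg_modulus (S : seq X) (f : X -> R) (r kappa : R) l :
  (0 < size S)%N ->
  (forall t s s' x,
    mdist s s' < r -> `|f (t * s * x)%g - f (t * s' * x)%g| <= kappa) ->
  forall s s' x, mdist s s' < r ->
    word_avg S f l (s * x)%g - word_avg S f l (s' * x)%g <= kappa.
Proof.
move=> S0 fr s s' x ss'; rewrite /word_avg -mulrBl -sumrB.
have Sl0 : 0 < (size S ^ l)%:R :> R by rewrite ltr0n expn_gt0 S0.
rewrite ler_pdivrMr// mulrC -size_words.
by apply: sum_seq_le => w; rewrite !mulgA (le_trans (ler_norm _))// fr.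
Qed.

(* One of the [size S] summands of [word_avg S f l.+1 x] is [kappa]-close to
   any prescribed value of [word_avg S f l], so that each step multiplies the
   oscillation by [(size S - 1) / size S], up to [kappa]. *)
Lemma word_avg_oscillation (S : seq X) (f : X -> R) (r kappa M : R) :
  (forall x, `|f x| <= M) ->
  (forall t s s' x,
    mdist s s' < r -> `|f (t * s * x)%g - f (t * s' * x)%g| <= kappa) ->
  0 <= kappa -> (0 < size S)%N ->
  (forall x, exists2 s, s \in S & mdist x s < r) ->
  forall l x z, word_avg S f l x - word_avg S f l z <=
    ((size S).-1%:R / (size S)%:R) ^+ l * (2 * M) + kappa.
Proof.
move=> fM fr kappa0 S0 Sr.
have n0 : 0 < (size S)%:R :> R by rewrite ltr0n.
have nE : (size S)%:R = (size S).-1%:R + 1 :> R by rewrite natr1 prednK.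
elim=> [|l IHl] x z.
  rewrite !word_avg0 expr0 mul1r.
  have := fM x; have := fM z; rewrite !ler_norml => /andP[? _] /andP[_ ?]; lra.
set q := _ / _ in IHl *; set D := q ^+ l.+1 * (2 * M) + kappa.
have step z' : word_avg S f l.+1 x - word_avg S f l z' <= D.
  have [s0 s0S zs0] := Sr (z' * x^-1)%g.
  rewrite word_avgS sum_seq_sub// ler_pdivrMr//.
  rewrite (perm_big _ (perm_to_rem s0S))/= big_cons.
  have s0z : word_avg S f l (s0 * x)%g - word_avg S f l z' <= kappa.
    rewrite -{1}(mulgKV x z'); apply: word_avg_modulus fr _ _ _ _ => //.
    by rewrite metric_sym.
  (* The remaining summands obey the induction hypothesis. The error is [kappa] for every summand,
     so its mean is again [kappa] and it does not accumulate with [l]. *)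
  have := sum_seq_le (rem s0 S) (fun s => IHl (s * x)%g z').
  rewrite size_rem// => /(lerD s0z)/le_trans; apply.
  rewrite /D exprS -mulrA; set P := q ^+ l * _.
  rewrite /q nE; set n : R := (size S).-1%:R.
  have n10 : n + 1 != 0 by rewrite /n -nE gt_eqF.
  suff -> : (n / (n + 1) * P + kappa) * (n + 1) = kappa + n * (P + kappa) by [].
  by field.
(* [step] compares length [l.+1] at [x] with length [l] at any point; averaging over the points
   [s * z] raises the second length as well. *)
rewrite [X in _ - X]word_avgS -opprB sum_seq_sub// -mulNr -sumrN.
rewrite ler_pdivrMr// mulrC; apply: sum_seq_le => s; rewrite opprB; exact: step.
Qed.

Lemma continuous_bounded (f : X -> R) : continuous f ->
  exists M : R, forall x, `|f x| <= M.
Proof.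
by apply: (ultra_continuous_bounded omega_free) => u; exact: ultra_lim.
Qed.

Lemma continuous_integrable (mu : Prob R X) (f : X -> R) : continuous f ->
  mu.-integrable setT (EFin \o (f : borel X -> R)).
Proof.
move=> cf; apply: bounded_continuous_integrable => //.
exact: continuous_bounded.
Qed.

Lemma continuous_sum_seq (I : Type) (s : seq I) (F : I -> X -> R) :
  (forall i, continuous (F i)) -> continuous (fun x => \sum_(i <- s) F i x).
Proof.
move=> cF; elim: s => [|i s IHs] x.
  under eq_fun do rewrite big_nil; exact: cvg_cst.
under eq_fun do rewrite big_cons; apply: cvgD; [exact: cF|exact: IHs].
Qed.

Lemma Rintegral_sum_seq (mu : Prob R X) (I : Type) (s : seq I)
    (F : I -> X -> R) :
  (forall i, continuous (F i)) ->
  (\int[mu]_x (\sum_(i <- s) F i x))%R =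
  \sum_(i <- s) (\int[mu]_x (F i x))%R.
Proof.
move=> cF; elim: s => [|i s IHs].
  under eq_Rintegral do rewrite big_nil.
  by rewrite big_nil Rintegral_cst// mul0r.
under eq_Rintegral do rewrite big_cons.
rewrite big_cons RintegralD ?IHs//; apply: continuous_integrable => //.
exact: continuous_sum_seq.
Qed.

Variables (mX : Prob R X) (mX_haar : haar mX).

Lemma mulgl_continuous (s : X) : continuous (fun x : X => s * x)%g.
Proof.
move=> x; apply: (@continuous_comp _ _ _ (fun x : X => (s, x))
  (fun p : X * X => p.1 * p.2)%g); last exact: mulg_continuous.
by apply: cvg_pair; [exact: cvg_cst|exact: cvg_id].
Qed.

Lemma haar_integral_shift (f : X -> R) (s : X) : continuous f ->
  (\int[mX]_x (f (s * x)%g : R))%R = (\int[mX]_x (f x : R))%R.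
Proof.
move=> cf.
pose T (x : borel X) : borel X := (s * x)%g.
have mT : measurable_fun setT T.
  apply: (@measurability _ _ _ _ setT T (@open X)) => //.
  move=> _ [U oU <-]; rewrite setTI; apply: sub_sigma_algebra => /=.
  by apply: open_comp oU => x _; exact: mulgl_continuous.
have cfT : continuous (fun x : X => f (s * x)%g).
  by move=> x; apply: continuous_comp; [exact: mulgl_continuous|exact: cf].
congr fine; transitivity (\int[pushforward mX T]_x (f x)%:E)%E.
  rewrite (integral_pushforward mT)//.
  - by apply/measurable_EFinP; exact: borel_continuous_measurable.
  - exact: continuous_integrable.
by apply: eq_measure_integral => A mA _; exact: mX_haar.
Qed.

Lemma continuous_word_avg (S : seq X) (f : X -> R) l : continuous f ->
  continuous (word_avg S f l).
Proof.
move=> cf x; apply: cvgMr_tmp.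
apply: (@continuous_sum_seq _ _ (fun w x => f (w * x)%g)) => w y.
by apply: continuous_comp; [exact: mulgl_continuous|exact: cf].
Qed.

Lemma haar_word_avg (S : seq X) (f : X -> R) l : continuous f ->
  (0 < size S)%N ->
  (\int[mX]_x (word_avg S f l x : R))%R = (\int[mX]_x (f x : R))%R.
Proof.
move=> cf S0; rewrite /word_avg.
have cF w : continuous (fun x : X => f (w * x)%g).
  by move=> x; apply: continuous_comp; [exact: mulgl_continuous|exact: cf].
rewrite RintegralZr//; last first.
  by apply: continuous_integrable; exact: continuous_sum_seq.
rewrite Rintegral_sum_seq//.
under eq_bigr do rewrite haar_integral_shift//.
rewrite big_const_seq count_predT iter_addr addr0 size_words.
by rewrite -[X in X / _]mulr_natr mulfK// pnatr_eq0 -lt0n expn_gt0 S0.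
Qed.

(** By left invariance the word average has the same Haar integral as [f]; a function of small
    oscillation is close to its integral at every point, in particular at 1. *)
Lemma word_avg_equidistributed (S : seq X) (f : X -> R) (r kappa M : R) l :
  continuous f -> (forall x, `|f x| <= M) ->
  (forall t s s' x,
    mdist s s' < r -> `|f (t * s * x)%g - f (t * s' * x)%g| <= kappa) ->
  0 <= kappa -> (0 < size S)%N ->
  (forall x, exists2 s, s \in S & mdist x s < r) ->
  `|(\int[mX]_x (f x : R))%R - word_avg S f l 1%g| <=
    ((size S).-1%:R / (size S)%:R) ^+ l * (2 * M) + kappa.
Proof.
move=> cf fM fr kappa0 S0 Sr; rewrite -(haar_word_avg l cf S0).
have osc := word_avg_oscillation fM fr kappa0 S0 Sr l.
set D := _ + kappa in osc *; set c := word_avg S f l 1%g.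
have cavg : continuous (word_avg S f l) by exact: continuous_word_avg.
have cst (b : R) : (\int[mX]_x b)%R = b.
  rewrite Rintegral_cst//; transitivity (b * fine (1%E : \bar R)).
    by congr (_ * fine _); exact: probability_setT.
  by rewrite mulr1.
have ccst (b : R) : mX.-integrable setT (EFin \o (fun=> b)).
  by apply: (@continuous_integrable mX (fun=> b)) => x; exact: cvg_cst.
rewrite ler_norml lerBrDr lerBlDr; apply/andP; split.
  rewrite -[leLHS]cst; apply: le_Rintegral => //.
    exact: continuous_integrable.
  by move=> x _; have := osc 1%g x; rewrite -/c; lra.
rewrite -[leRHS]cst; apply: le_Rintegral => //.
  exact: continuous_integrable.
by move=> x _; have := osc x 1%g; rewrite -/c; lra.
Qed.

End RandomWords.

(** * Absorbing subgroups *)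

Section Saturation.
Variables (R : realType) (G : groupType) (X : compactMetricGroupType R).
Variables (a : G -> X -> X) (d : nat -> nat) (d_gt0 : forall k, (0 < d k)%N).
Variables (sigma : forall k, G -> 'S_(d k)).
Variables (omega : set_system nat) (omega_free : free_ultrafilter omega).
Hypothesis a_algebraic : algebraic_action a.
Let ultra_omega : UltraFilter omega := omega_free.1.
Local Existing Instance ultra_omega.

Local Notation mseq := (mseq X d).
Local Notation microstates := (microstates a sigma omega).

Definition covered (e : R) (Psi Phi : seq mseq) k : set 'I_(d k) :=
  [set j | values Psi k j `<=` thickening e (values Phi k j)].

Definition approximated (e : R) (Phi : seq mseq)
    (Z : forall k, 'I_(d k) -> closedSubgroup X) k : set 'I_(d k) :=
  [set j | values Phi k j `<=` thickening e (Z k j) /\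
           Z k j `<=` thickening e (values Phi k j)].

Local Arguments covered : clear implicits.
Local Arguments approximated : clear implicits.

Lemma saturated_approximate_subgroup (e : R) : 0 < e ->
  exists (Phi : seq mseq) (Z : forall k, 'I_(d k) -> closedSubgroup X),
  [/\ microstates Phi, (0 < size Phi)%N,
    forall Psi, microstates Psi ->
      omega [set k | unif R (~` covered e Psi Phi k) <= e] &
    omega [set k | unif R (~` approximated e Phi Z k) <= e]].
Proof.
move=> e0; have [r r0 rK] := approximate_subgroup X omega_free e0.
(* [r] is the accuracy at which sets of values become approximate subgroups, [e] the one demanded of
   the covering. *)
have re0 : 0 < Num.min r e by rewrite lt_min r0 e0.
have [Phi0 Phi0M sat] :=
  microstates_saturated a d_gt0 sigma omega_free re0 e0.
(* Adjoining the trivial sequence makes every set of values nonempty, as [approximate_subgroup]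
   requires. *)
pose Phi : seq mseq := (fun k j => 1%g) :: Phi0.
have PhiM : microstates Phi.
  move=> phi; rewrite inE => /predU1P[->|/Phi0M//].
  exact: microstate1.
have satPhi Psi : microstates Psi -> omega [set k | unif R (~` [set j |
    values Psi k j `<=` thickening (Num.min r e) (values Phi k j)]) <= e].
  move=> /sat; apply: filterS => k; apply: le_trans; apply: le_unif.
  apply: subsetC => j PsiPhi x /PsiPhi[y [phi phiM yE] xy]; exists y => //.
  by exists phi => //; rewrite inE phiM orbT.
have /choice[K KP] : forall W : set X, exists K : closedSubgroup X,
    W !=set0 -> (forall x y, W x -> W y -> thickening r W (x * y^-1)%g) ->
    W `<=` thickening e K /\ K `<=` thickening e W.
  move=> W; have [W0|W0] := pselect (W !=set0); last first.
    by exists (full_subgroup X) => /W0.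
  have [WV|nWV] := pselect (forall x y, W x -> W y ->
      thickening r W (x * y^-1)%g); last by exists (full_subgroup X) => _ /nWV.
  by have [K KW] := rK W W0 WV; exists K.
exists Phi, (fun k j => K (values Phi k j)); split => //.
  move=> Psi /satPhi; apply: filterS => k; apply: le_trans; apply: le_unif.
  apply: subsetC => j PsiPhi x /PsiPhi[y yPhi xy]; exists y => //.
  by rewrite (lt_le_trans xy)// ge_min lexx orbT.
pose PhiV : seq mseq :=
  [seq (fun k j => (phi k j * (psi k j)^-1)%g) : mseq | phi <- Phi, psi <- Phi].
have /satPhi : microstates PhiV.
  move=> _ /allpairsP[[phi psi] /= [phiM psiM ->]].
  by apply: microstate_div => //; exact: PhiM.
apply: filterS => k; apply: le_trans; apply: le_unif.
apply: subsetC => j VPhi; apply: KP.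
  by exists 1%g; exists (fun k j => 1%g); rewrite ?mem_head.
move=> _ _ [phi phiM ->] [psi psiM ->].
have [|y Phiy yV] := VPhi (phi k j * (psi k j)^-1)%g.
  exists (fun k j => (phi k j * (psi k j)^-1)%g) => //.
  exact: (allpairs_f
    (fun phi psi => (fun k j => (phi k j * (psi k j)^-1)%g) : mseq)).
by exists y => //; rewrite (lt_le_trans yV)// ge_min lexx.
Qed.

Fixpoint mwords (Phi : seq mseq) l : seq mseq :=
  if l is l'.+1 then
    [seq (fun k j => (w k j * phi k j)%g) : mseq
       | w <- mwords Phi l', phi <- Phi]
  else [:: (fun k j => 1%g)].

(** Evaluation at a coordinate commutes with forming words, so the marginal of a random word of
    sequences is the random word in the letters at that coordinate. *)
Lemma mwords_eval (Phi : seq mseq) l k j :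
  [seq w k j | w : mseq <- mwords Phi l] =
  words [seq phi k j | phi : mseq <- Phi] l.
Proof.
elim: l => //= l <-; rewrite map_allpairs allpairs_mapl allpairs_mapr.
by [].
Qed.

Lemma size_mwords (Phi : seq mseq) l : size (mwords Phi l) = (size Phi ^ l)%N.
Proof. by elim: l => //= l IHl; rewrite size_allpairs IHl expnSr. Qed.

Lemma microstates_mwords (Phi : seq mseq) l :
  microstates Phi -> microstates (mwords Phi l).
Proof.
move=> PhiM; elim: l => [|l IHl] /=.
  by move=> phi; rewrite inE => /eqP ->; exact: microstate1.
move=> _ /allpairsP[[w phi] /= [wM phiM ->]].
by apply: microstateM => //; [exact: IHl|exact: PhiM].
Qed.

End Saturation.

Arguments covered {R X d} e Psi Phi k.
Arguments approximated {R X d} e Phi Z k.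

Lemma expr_small (R : realType) (q e : R) : 0 <= q < 1 -> 0 < e ->
  exists l, q ^+ l <= e.
Proof.
move=> /andP[q0 q1] e0; have q1' : `|q| < 1 by rewrite ger0_norm.
have /cvgr0Pnorm_le/(_ _ e0)[N _ Nq] := cvg_expr q1'.
by exists N; have := Nq N (leqnn N); rewrite /= ger0_norm// exprn_ge0.
Qed.

Lemma countable_enum (G : groupType) : countable [set: G] ->
  exists g : nat -> G, forall h, exists i, g i = h.
Proof.
move=> /countable_injP[f finj].
have /choice[g gP] : forall i, exists h, (exists h', f h' = i) -> f h = i.
  move=> i; have [[h fh]|nh] := pselect (exists h, f h = i); first by exists h.
  by exists 1%g => /nh.
exists g => h; exists (f h); apply: finj; rewrite ?in_setT//.
by apply: gP; exists h.
Qed.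

Lemma setdist_lt (R : realType) (X : compactMetricGroupType R) (e : R)
    (K : set X) (x : X) : thickening e K x -> setdist x K < e.
Proof.
move=> [y Ky]; apply: le_lt_trans; apply: ge_inf; last by exists y.
by exists 0 => _ [z _ <-]; exact: mdist_ge0.
Qed.

Section Absorbing.
Variables (R : realType) (G : groupType) (G_countable : countable [set: G]).
Variables (X : compactMetricGroupType R).
Variables (a : G -> X -> X) (d : nat -> nat) (d_gt0 : forall k, (0 < d k)%N).
Variables (sigma : forall k, G -> 'S_(d k)).
Variables (omega : set_system nat) (omega_free : free_ultrafilter omega).
Hypothesis a_algebraic : algebraic_action a.
Variables (mX : Prob R X) (mX_haar : haar mX).
Let ultra_omega : UltraFilter omega := omega_free.1.
Local Existing Instance ultra_omega.

Local Notation mseq := (mseq X d).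
Local Notation microstate := (topological_microstates a sigma omega).
Local Notation microstates := (microstates a sigma omega).
Local Notation eta n := (n.+1%:R^-1 : R).

Lemma thickening_le (e e' : R) (K : set X) : e <= e' ->
  thickening e K `<=` thickening e' K.
Proof. by move=> ee x [y Ky xy]; exists y => //; exact: lt_le_trans ee. Qed.

Lemma thickening_add (e1 e2 : R) (A B : set X) : A `<=` thickening e2 B ->
  thickening e1 A `<=` thickening (e1 + e2) B.
Proof.
move=> AB x [y /AB[z Bz yz] xy]; exists z => //.
by rewrite (le_lt_trans (metric_triangle _ y _))// ltrD.
Qed.

Lemma eta_le n m : (n <= m)%N -> eta m <= eta n.
Proof. by move=> nm; rewrite lef_pV2 ?posrE// ler_nat ltnS. Qed.

Lemma eta_lt (e : R) : 0 < e -> exists n, eta n < e.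
Proof. by move=> /(free_ultra_inv omega_free)/(ultra_nempty omega_free). Qed.

Lemma unif_most (A : forall k, set 'I_(d k)) (m : nat -> nat) :
  (forall n, omega [set k | (n <= m k)%N]) ->
  omega [set k | unif R (~` A k) <= eta (m k)] -> most R omega A.
Proof.
move=> wm wA e' /eta_lt[n ne]; apply: filterS2 (wm n) wA => k nm.
by move=> /le_trans; apply; apply: le_trans (eta_le nm) (ltW ne).
Qed.

Lemma ultra_cvg1 (u : nat -> \bar R) : omega [set k | u k = 1%E] ->
  u @ omega --> 1%E.
Proof. exact: cvg_near_cst. Qed.

Section Mu.
Variables (W : nat -> seq mseq) (W0 : forall k, (0 < size (W k))%N).

Definition word_measure k : Prob R {ptws 'I_(d k) -> X} :=
  unif_pushforward R (W0 k)
    (fun i => nth (fun k j => point) (W k) i k : {ptws 'I_(d k) -> X}).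

Lemma word_measure_supp k (A : set {ptws 'I_(d k) -> X}) :
  (forall w, w \in W k -> A (w k)) -> word_measure k A = 1%E.
Proof.
move=> WA; rewrite /word_measure /= /unif_image.
rewrite (_ : _ @^-1` _ = setT); last first.
  by apply/seteqP; split=> // i _; apply: WA; exact: mem_nth.
by rewrite unif_sum (eq_bigr (fun=> 1)) ?sumr_const ?card_ord
  ?divff// ?pnatr_eq0 -?lt0n// => j _; rewrite asboolT.
Qed.

Lemma integral_word_marginal k (j : 'I_(d k)) (f : X -> R) : continuous f ->
  (\int[marginal (word_measure k) j]_x (f x : R))%R =
  (\sum_(x <- [seq w k j | w : mseq <- W k]) f x) / (size (W k))%:R.
Proof.
move=> cf; transitivity (\int[unif_pushforward R (W0 k)
    (fun i => (nth (fun k j => point) (W k) i : mseq) k j)]_x (f x : R))%R.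
  by congr fine; apply: eq_measure_integral => A _ _.
rewrite integral_unif_pushforward//; congr (_ / _).
rewrite big_map (big_nth (fun k j => point)) big_mkord.
by [].
Qed.

End Mu.

(** Both claims belong to one lemma because the measures are built from the same families as [Y]. *)
Lemma absorbing_or_equidistributed :
  exists Y : forall k, 'I_(d k) -> closedSubgroup X,
    absorbs a sigma omega Y /\
    ((forall e : R, 0 < e ->
       most R omega (fun k => [set j | mdist (Y k j) (full_subgroup X) < e])) ->
     exists mu : forall k, Prob R {ptws 'I_(d k) -> X},
       asymptotically_supported a sigma omega mu /\
       locally_weak_star_cvg omega mu mX).
Proof.
have eta0 n : 0 < eta n by [].
have /choice[Phi PhiP] := fun n => saturated_approximate_subgroup d_gt0 sigma
  omega_free a_algebraic (eta0 n).
have /choice[Z ZP] := PhiP.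
have PhiM n : microstates (Phi n) by case: (ZP n).
have Phi0 n : (0 < size (Phi n))%N by case: (ZP n).
have sat n Psi : microstates Psi ->
    omega [set k | unif R (~` covered (eta n) Psi (Phi n) k) <= eta n].
  by case: (ZP n) => _ _ + _; apply.
have appr n : omega [set k |
    unif R (~` approximated (eta n) (Phi n) (Z n) k) <= eta n].
  by case: (ZP n).
have [g gP] := countable_enum G_countable.
pose q n : R := (size (Phi n)).-1%:R / (size (Phi n))%:R.
(* The contraction factor [q n] is less than 1 and depends only on the size of [Phi n], so the
   length is fixed before [k] and [j]. *)
have /choice[L LP] : forall n, exists l, q n ^+ l <= eta n.
  move=> n; apply: expr_small => //; rewrite divr_ge0//=.
  by rewrite ltr_pdivrMr ?ltr0n// mul1r ltr_nat prednK.
(* The demands of scale [n] are finite in number: [Phi n] covers its predecessors, [Z n]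
   approximates it, and its words are almost equivariant under the first [n.+1] listed group
   elements. *)
pose A n := [set k | [/\
  forall i, (i <= n)%N -> unif R (~` covered (eta n) (Phi i) (Phi n) k) <= eta n,
  unif R (~` approximated (eta n) (Phi n) (Z n) k) <= eta n &
  forall i, (i <= n)%N -> forall w, w \in mwords (Phi n) (L n) ->
    unif R (~` [set j | mdist (a (g i) (w k j)) (w k (sigma k (g i) j)) < eta n])
      <= eta n]].
have wA n : omega (A n).
  have w1 := ultra_all_le omega_free n (fun i => sat n _ (PhiM i)).
  have w3 : omega [set k | forall i, (i <= n)%N ->
      forall w, w \in mwords (Phi n) (L n) -> unif R (~` [set j |
        mdist (a (g i) (w k j)) (w k (sigma k (g i) j)) < eta n]) <= eta n].
    apply: (ultra_all_le omega_free) => i.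
    apply: (ultra_all_seq omega_free) => w wM.
    have wMn := microstates_mwords d_gt0 omega_free a_algebraic (PhiM n) wM.
    exact: ((microstateP _ d_gt0 _ omega_free w).1 wMn _ _ (eta0 n) _ (eta0 n)).
  by apply: filterS3 w1 (appr n) w3 => k; split.
have [m mP] := diagonal_index omega_free wA.
have wm n : omega [set k | (n <= m k)%N] by apply: filterS (mP n) => k [].
have Am : omega [set k | A (m k) k] by apply: filterS (mP 0%N) => k [].
have approx : most R omega (fun k =>
    approximated (eta (m k)) (Phi (m k)) (Z (m k)) k).
  by apply: (unif_most wm); apply: filterS Am => k [].
exists (fun k j => Z (m k) k j); split.
  move=> phi phiM e e0; apply/(mostP _ d_gt0 omega_free) => delta delta0.
  have e30 : 0 < Num.min (e / 3) (delta / 3) by rewrite lt_min !divr_gt0.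
  have delta30 : 0 < delta / 3 by rewrite divr_gt0.
  have [i] := eta_lt e30; rewrite lt_min => /andP[ie idelta].
  have phiMs : microstates [:: (phi : mseq)].
    by move=> psi; rewrite inE => /eqP ->.
  have coveredM : most R omega (fun k =>
      covered (eta (m k)) (Phi i) (Phi (m k)) k).
    by apply: (unif_most wm); apply: filterS2 (wm i) Am => k im [+ _ _]; apply.
  have Fomega : Filter omega by exact: _.
  have w1 := @filterI _ _ Fomega _ _ (wm i) (sat i _ phiMs).
  have w2 : omega [set k | unif R (~` covered (eta (m k)) (Phi i) (Phi (m k)) k)
      <= delta / 3] by exact: coveredM.
  have w3 : omega [set k | unif R (~` approximated (eta (m k)) (Phi (m k))
      (Z (m k)) k) <= delta / 3] by exact: approx.
  apply: filterS3 w1 w2 w3 => k [/= im c1] c2 c3.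
  apply: (@le_trans _ _ (delta / 3 + delta / 3 + delta / 3)); last by lra.
  apply: le_trans (lerD (lerD (le_trans c1 (ltW idelta)) c2) c3).
  apply: le_trans (lerD (unifU _ _ _) (lexx _)).
  apply: le_trans (unifU _ _ _); rewrite -!setCI; apply: le_unif.
  (* The path from [phi] to [Y] passes through [Phi i] and [Phi (m k)]; each of its three legs is
     shorter than [e / 3], and each fails on a proportion at most [delta / 3]. *)
  apply: subsetC => j [[cov1 cov2] [PhiZ _]] /=; apply: setdist_lt.
  apply: (@thickening_le (eta i + (eta (m k) + eta (m k)))).
    by move: (eta_le im) ie; move: (eta i) (eta (m k)) => x y yx xe; lra.
  have [|y Py xy] := cov1 (phi k j); first by exists phi; rewrite ?mem_head.
  apply: (thickening_add (A := values (Phi i) k j)); last by exists y.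
  by move=> x /cov2; exact: thickening_add.
move=> Yfull.
pose W k := mwords (Phi (m k)) (L (m k)).
have W0 k : (0 < size (W k))%N by rewrite size_mwords expn_gt0 Phi0.
exists (word_measure W0); split.
  move=> h delta U delta0 _ dU; have [i <-] := gP h.
  have [e e0 eU] := diag_nbhs_mdist omega_free dU.
  have ed0 : 0 < Num.min e delta by rewrite lt_min e0.
  have [n] := eta_lt ed0; rewrite lt_min => /andP[ne nd].
  (* Every single word satisfies the event, so its probability equals 1 for [omega]-many [k]. *)
  apply: ultra_cvg1; apply: filterS3 (wm i) (wm n) Am => k im nm [_ _ Ak].
  apply: word_measure_supp => w wM /=.
  have := Ak i im w wM; rewrite unifC// lerBlDr -lerBlDl => wk.
  apply: (@le_trans _ _ (1 - eta (m k))).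
    by rewrite lerB// (le_trans (eta_le nm))// ltW.
  apply: le_trans wk _; apply: le_unif => j /= wj; apply: eU.
  by rewrite metric_sym (lt_trans wj)// (le_lt_trans (eta_le nm)).
(* Local weak-star convergence is convergence of this one filter, which allows testing a single
   continuous function at a time. *)
pose F : set_system (Prob R X) := [set O | most R omega (fun k =>
  [set j | O (marginal (word_measure W0 k) j)])].
have FF : Filter F.
  split; first exact: (mostT d_gt0 omega_free).
    by move=> O1 O2 F1 F2; exact: (mostI omega_free F1 F2).
  by move=> O1 O2 O12; apply: (mostS omega_free) => k j; exact: O12.
suff FmX : F --> mX by move=> O /FmX FO; apply/(mostP _ d_gt0 omega_free).
apply/weak_star_cvgP => f cf; apply/cvgrPdist_le => e e0.
have e20 : 0 < e / 2 by rewrite divr_gt0.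
have [r r0 fr] := continuous_mul_heine omega_free cf e20.
have [M fM] := continuous_bounded omega_free cf.
have M0 : 0 <= M by exact: le_trans (fM 1%g).
have r20 : 0 < r / 2 by rewrite divr_gt0.
have small : most R omega (fun k => [set j : 'I_(d k) |
    eta (m k) < r / 2 /\ eta (m k) * (2 * M) <= e / 2]).
  apply: (most_near d_gt0 omega_free).
  (* One half of [r] is for the distance from [X] to the subgroup, the other for that from the
     subgroup to the letters. The summand 1 keeps the denominator positive when [M = 0]. *)
  have c0 : 0 < Num.min (r / 2) (e / 2 / (2 * M + 1)).
    by rewrite lt_min r20 divr_gt0// ltr_wpDl// mulr_ge0.
  have [n] := eta_lt c0; rewrite lt_min => /andP[nr nM].
  apply: filterS (wm n) => k nm; apply/seteqP; split=> // j _ /=.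
  split; first exact: le_lt_trans (eta_le nm) nr.
  move: nM; rewrite ltr_pdivlMr ?ltr_wpDl ?mulr_ge0// => nM.
  apply: le_trans (ltW nM); apply: ler_pM; rewrite ?mulr_ge0//.
    exact: eta_le.
  by rewrite lerDl.
have near_full := mostI omega_free approx (Yfull _ r20).
apply: (mostS omega_free) (mostI omega_free near_full small).
move=> k j [[[PZ ZPhi] /mdist_full_lt Yf] [mr mM]] /=.
rewrite integral_word_marginal// size_mwords mwords_eval.
pose S := [seq phi k j | phi : mseq <- Phi (m k)].
have S0 : (0 < size S)%N by rewrite size_map.
have Sr x : exists2 s, s \in S & mdist x s < r.
  have [_ [phi phiM ->] xphi] := thickening_add ZPhi (Yf x).
  exists (phi k j); first exact: (map_f (fun phi : mseq => phi k j)).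
  by rewrite (lt_le_trans xphi)//; move: (eta (m k)) mr => y yr; lra.
have := word_avg_equidistributed omega_free mX_haar (L (m k)) cf fM fr
  (ltW e20) S0 Sr.
rewrite /word_avg; under eq_bigr do rewrite mulg1.
rewrite size_map => /le_trans; apply; rewrite [leRHS]splitr lerD//.
by apply: le_trans mM; rewrite ler_wpM2r ?mulr_ge0//; exact: LP.
Qed.

End Absorbing.

(** * Subgroups far from the whole group *)

Lemma lipschitz_continuous (R : realType) (T : metricType R) (f : T -> R)
    (C : R) :
  0 < C -> (forall x y, f x - f y <= C * mdist x y) -> continuous f.
Proof.
move=> C0 fC x; apply/cvgrPdist_lt => e e0.
have eC0 : 0 < e / C by rewrite divr_gt0.
apply/nbhs_ballP; exists (e / C) => //= y; rewrite ballEmdist/= ltr_pdivlMr//.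
rewrite mulrC => xy; rewrite ltr_norml ltrNl opprB.
by rewrite !(le_lt_trans (fC _ _))// metric_sym.
Qed.

(** * Convergence of pushforwards to the point mass at the full subgroup *)

Section PointMass.
Variables (R : realType) (X : compactMetricGroupType R).
Variables (d : nat -> nat) (d_gt0 : forall k, (0 < d k)%N).
Variables (omega : set_system nat) (omega_free : free_ultrafilter omega).
Variable Y : forall k, 'I_(d k) -> closedSubgroup X.
Let ultra_omega : UltraFilter omega := omega_free.1.
Local Existing Instance ultra_omega.

Lemma integral_point_mass (T : ptopologicalType) (x : T) (f : T -> R) :
  continuous f -> (\int[point_mass R x]_y (f y : R))%R = f x.
Proof.
move=> cf; rewrite /Rintegral /point_mass integral_dirac//.
  by rewrite diracT mul1e.
by apply/measurable_EFinP; exact: borel_continuous_measurable.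
Qed.

(** Convergence to a point mass is convergence in measure: one direction is Markov's inequality for
    the distance to [X], the other splits the mean of a bounded continuous function into near and
    far coordinates. *)
Lemma pushforward_cvg_full :
  ((fun k => unif_pushforward R (d_gt0 k) (@Y k)) @ omega -->
    point_mass R (full_subgroup X)) <->
  (forall e : R, 0 < e ->
    most R omega (fun k => [set j | mdist (@Y k j) (full_subgroup X) < e])).
Proof.
rewrite (weak_star_cvgP _ (fmap_filter _ _)).
split=> [cY e e0 delta delta0|mY f cf].
  pose f (K : closedSubgroup X) := mdist K (full_subgroup X).
  have cf : continuous f.
    apply: (@lipschitz_continuous _ _ f 1) => // K L; rewrite mul1r lerBlDr.
    exact: metric_triangle.
  have /cvgrPdist_le/(_ (e * delta) (mulr_gt0 e0 delta0)) := cY f cf.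
  rewrite integral_point_mass// /f mdistxx => cYe.
  have {}cYe : omega [set k | `|0 - (\int[unif_pushforward R (d_gt0 k) (@Y k)]_K
    (f K : R))%R| <= e * delta] by exact: cYe.
  apply: filterS cYe => k /=.
  rewrite integral_unif_pushforward// sub0r normrN ger0_norm; last first.
    by rewrite divr_ge0// sumr_ge0// => j _; exact: mdist_ge0.
  rewrite -ler_pdivrMl// => fe; apply: le_trans fe.
  rewrite unif_sum mulrA ler_wpM2r ?invr_ge0// mulr_sumr.
  apply: ler_sum => j _; case: asboolP => /= [/negP|_]; last first.
    by rewrite mulr_ge0 ?invr_ge0 ?mdist_ge0// ltW.
  by rewrite -leNgt => eY; rewrite mulrC ler_pdivlMr// mul1r.
rewrite integral_point_mass//; apply/cvgrPdist_le => e e0.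
have [M fM] :=
  ultra_continuous_bounded omega_free (csub_ultra_lim omega_free) cf.
have M0 : 0 <= M by exact: le_trans (fM (full_subgroup X)).
have e20 : 0 < e / 2 by rewrite divr_gt0.
have /cvgrPdist_lt/(_ _ e20)/nbhs_ballP[r /= r0 rf] := cf (full_subgroup X).
have c0 : 0 < e / 2 / (2 * M + 1) by rewrite divr_gt0// ltr_wpDl// mulr_ge0.
suff fY : omega [set k | `|f (full_subgroup X) -
    (\int[unif_pushforward R (d_gt0 k) (@Y k)]_K (f K : R))%R| <= e].
  exact: fY.
apply: filterS (mY _ r0 _ c0) => k /= bad.
rewrite integral_unif_pushforward// distrC; set c := f (full_subgroup X).
have dk0 : (d k)%:R != 0 :> R by rewrite pnatr_eq0 -lt0n.
have -> : (\sum_j f (@Y k j)) / (d k)%:R - c =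
    (\sum_j (f (@Y k j) - c)) / (d k)%:R.
  by rewrite sumrB sumr_const card_ord mulrBl -[c *+ _]mulr_natr mulfK.
rewrite normrM [X in _ * X]ger0_norm ?invr_ge0//.
pose B : set 'I_(d k) := ~` [set j | mdist (@Y k j) (full_subgroup X) < r].
apply: (@le_trans _ _
    ((\sum_(j < d k) (e / 2 + 2 * M * `[< B j >]%:R)) / (d k)%:R)).
  rewrite ler_wpM2r ?invr_ge0//; apply: le_trans (ler_norm_sum _ _ _) _.
  apply: ler_sum => j _; case: asboolP => /= [_|/contrapT Yr].
    rewrite mulr1; have := fM (@Y k j); have := fM (full_subgroup X).
    have := ler_normB (f (@Y k j)) c; rewrite -/c; lra.
  by rewrite mulr0 addr0 distrC ltW// rf// ballEmdist/= metric_sym.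
rewrite big_split/= sumr_const card_ord -[_ *+ _]mulr_natr mulrDl mulfK//.
have -> : (\sum_(j < d k) 2 * M * `[< B j >]%:R) / (d k)%:R = 2 * M * unif R B.
  by rewrite unif_sum mulrA mulr_sumr.
rewrite [leRHS]splitr lerD2l.
apply: (@le_trans _ _ ((2 * M + 1) * (e / 2 / (2 * M + 1)))).
  by apply: ler_pM; rewrite ?mulr_ge0 ?unif_ge0// lerDl.
by rewrite mulrC divfK// gt_eqF// ltr_wpDl// mulr_ge0.
Qed.

End PointMass.

Section FiniteFubini.
Variables (R : realType) (dT : measure_display) (T : measurableType dT).
Variable P : probability T R.

(** Integrates a pointwise count on [C]; this passes from proportions of coordinates for each
    configuration to probabilities for each coordinate. *)
Lemma le_sum_probability n (E : 'I_n -> set T) (C : set T) (c : R) :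
  measurable C -> (forall j, measurable (E j)) -> 0 <= c ->
  (forall x, C x -> c <= \sum_j `[< E j x >]%:R) ->
  (c%:E * P C <= \sum_j P (E j))%E.
Proof.
move=> mC mE c0 CE.
have mI j : measurable_fun setT (fun x => (\1_(E j) x)%:E : \bar R).
  by apply/measurable_EFinP; exact: measurable_indic.
have -> : (\sum_j P (E j) = \int[P]_x (\sum_j (\1_(E j) x)%:E))%E.
  rewrite ge0_integral_sum//.
  by apply: eq_bigr => j _; rewrite integral_indic// setIT.
have -> : (c%:E * P C = \int[P]_x (c * \1_C x)%:E)%E.
  under eq_integral do rewrite EFinM.
  rewrite ge0_integralZl//; last first.
    by apply/measurable_EFinP; exact: measurable_indic.
  by rewrite integral_indic// setIT.
apply: ge0_le_integral => //.
- by move=> x _; rewrite lee_fin mulr_ge0.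
- apply/measurable_EFinP.
  by apply: measurable_funM => //; exact: measurable_indic.
- exact: emeasurable_sum.
move=> x _; rewrite sumEFin lee_fin indicE.
case: (boolP (x \in C)) => [|_]; last by rewrite mulr0 sumr_ge0.
rewrite inE mulr1 => /CE/le_trans; apply; apply: ler_sum => j _.
by rewrite indicE.
Qed.

End FiniteFubini.

Section Thickening.
Variables (R : realType) (X : compactMetricGroupType R).
Variables (omega : set_system nat) (omega_free : free_ultrafilter omega).

Lemma thickening_open (e : R) (K : set X) : open (thickening e K).
Proof.
rewrite openE => x [y Ky xy]; apply/nbhs_ballP; exists (e - mdist x y) => /=.
  by rewrite subr_gt0.
move=> z; rewrite ballEmdist/= => xz; exists y => //.
rewrite (le_lt_trans (metric_triangle _ x _))// metric_sym.
by rewrite -ltrBrDr.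
Qed.

Lemma thickening_setdist (e : R) (K : set X) (x : X) : K !=set0 ->
  setdist x K < e -> thickening e K x.
Proof.
move=> [y Ky] xe.
have inf_xK : has_inf [set mdist x y | y in K].
  by split; [exists (mdist x y), y|exists 0 => _ [z _ <-]; exact: mdist_ge0].
have ex0 : 0 < e - setdist x K by rewrite subr_gt0.
have [_ [z Kz <-]] := inf_adherent ex0 inf_xK.
by rewrite addrC subrK => xz; exists z.
Qed.

Lemma setdist_lipschitz (K : set X) (x y : X) :
  setdist x K - setdist y K <= mdist x y.
Proof.
have [->|/set0P K0] := eqVneq K set0.
  by rewrite /setdist !image_set0 subrr mdist_ge0.
rewrite lerBlDr -lerBlDl; apply: lb_le_inf => [|_ [z Kz <-]].
  by case: K0 => z Kz; exists (mdist y z), z.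
rewrite lerBlDl (le_trans _ (metric_triangle _ y _))//.
apply: ge_inf; last by exists z.
by exists 0 => _ [t _ <-]; exact: mdist_ge0.
Qed.

(** A Urysohn function: 1 within distance [e] of [K], 0 from distance [2 * e] on, linear in
    between. *)
Definition plateau (e : R) (K : set X) (x : X) : R :=
  Num.min 1 (Num.max 0 (2 - setdist x K / e)).

Lemma plateau_continuous (e : R) (K : set X) : 0 < e ->
  continuous (plateau e K).
Proof.
move=> e0; apply: (@lipschitz_continuous _ _ _ e^-1); first by rewrite invr_gt0.
move=> x y; rewrite /plateau [e^-1 * _]mulrC.
have : setdist y K / e - setdist x K / e <= mdist x y / e.
  by rewrite -mulrBl ler_wpM2r ?invr_ge0 ?(ltW e0)// metric_sym setdist_lipschitz.
have : 0 <= mdist x y / e by rewrite divr_ge0 ?mdist_ge0// ltW.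
move: (setdist x K / e) (setdist y K / e) (mdist x y / e) => s t m m0 tsm.
by case: (leP 0 (2 - s)) => ?; case: (leP 0 (2 - t)) => ?;
  case: (leP 1 (2 - s)) => ?; case: (leP 1 (2 - t)) => ?;
  rewrite ?(min_r ler01); lra.
Qed.

End Thickening.

Section FarSubgroups.
Variables (R : realType) (X : compactMetricGroupType R).
Variables (omega : set_system nat) (omega_free : free_ultrafilter omega).
Variables (mX : Prob R X) (mX_haar : haar mX).

Lemma open_borel (T : ptopologicalType) (A : set T) :
  open A -> measurable (A : set (borel T)).
Proof. by move=> oA; exact: sub_sigma_algebra. Qed.

(* If [x] is far from [K], then the thickening [N] of [K] is disjoint from its
   translate by [x], so that [N] has Haar measure at most [1/2]. *)
Lemma haar_thickening_le (eta : R) : 0 < eta -> exists2 e : R, 0 < e &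
  forall K : closedSubgroup X, ~ mdist K (full_subgroup X) < eta ->
  (mX (thickening e K) <= (1 / 2)%:E)%E.
Proof.
move=> eta0; have eta20 : 0 < eta / 2 by rewrite divr_gt0.
have [e e0 divE] := @continuous2_heine _ _ _ omega_free
  (fun x y => x * y^-1)%g (@divg_continuous R X) _ eta20.
exists e => // K Kfar.
have [x xK] : exists x, ~ thickening (eta / 2) K x.
  apply/existsNP => xK; apply: Kfar.
  by rewrite (le_lt_trans (mdist_full_le eta20 xK))//; lra.
pose N : set (borel X) := thickening e K.
pose xN : set (borel X) := (fun y : X => (x * y)%g) @^-1` N.
have mN : measurable N by apply: open_borel; exact: thickening_open.
have mxN : measurable xN.
  apply: open_borel; apply: open_comp; last exact: thickening_open.
  by move=> y _; exact: mulgl_continuous.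
have NxN : N `&` xN = set0.
  apply/seteqP; split=> // y [[z Kz yz] [t Kt xyt]]; apply: xK.
  exists (t * z^-1)%g; first by apply: csub_M => //; exact: csub_V.
  by rewrite -(mulgK y x); exact: divE.
have Nfin : mX N \is a fin_num by exact: fin_num_measure.
have : (mX N + mX xN <= 1)%E.
  by rewrite -measureU//; apply: probability_le1; exact: measurableU.
have -> : mX xN = mX N by exact: mX_haar.
rewrite -/N -(fineK Nfin) -EFinD !lee_fin; lra.
Qed.

Lemma probability_le_integral (nu : Prob R X) (f : X -> R) (N : set X) :
  continuous f -> open N -> (forall x, 0 <= f x) ->
  (forall x, N x -> 1 <= f x) ->
  (nu N <= (\int[nu]_x (f x : R))%R%:E)%E.
Proof.
move=> cf /open_borel mN f0 fN.
rewrite fineK; last first.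
  by apply: integrable_fin_num => //; exact: (continuous_integrable omega_free).
rewrite -[N in X in (X <= _)%E]setIT -integral_indic//.
apply: ge0_le_integral => //.
- by apply/measurable_EFinP; exact: measurable_indic.
- by apply/measurable_EFinP; exact: borel_continuous_measurable.
move=> x _; rewrite lee_fin indicE; case: (boolP (x \in N)) => // /[!inE] Nx.
exact: fN.
Qed.

Lemma integral_le_probability (nu : Prob R X) (f : X -> R) (N : set X) :
  continuous f -> open N -> (forall x, 0 <= f x <= 1) ->
  (forall x, ~ N x -> f x = 0) ->
  ((\int[nu]_x (f x : R))%R%:E <= nu N)%E.
Proof.
move=> cf /open_borel mN f01 fN.
rewrite fineK; last first.
  by apply: integrable_fin_num => //; exact: (continuous_integrable omega_free).
rewrite -[N in X in (_ <= X)%E]setIT -integral_indic//.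
apply: ge0_le_integral => //.
- by move=> x _; rewrite lee_fin; case/andP: (f01 x).
- by apply/measurable_EFinP; exact: borel_continuous_measurable.
- by apply/measurable_EFinP; exact: measurable_indic.
move=> x _; rewrite lee_fin indicE; case: (boolP (x \in N)) => [_|].
  by case/andP: (f01 x).
by rewrite notin_setE => /fN ->.
Qed.

(** [O] must not depend on [K], so [K] is replaced by the union [T A] of the colour classes that it
    meets, which leaves finitely many test functions. [T A] lies within [r / 2] of [K] and its
    plateau vanishes from distance [2 * (r / 4)] on, so the Haar bound for the [r]-thickening
    applies; [5 / 8] is [1 / 2] plus the tolerance [1 / 8]. *)
Lemma weak_star_thickening_le (eta : R) : 0 < eta -> exists2 e : R, 0 < e &
  exists2 O : set (Prob R X), nbhs mX O &
  forall (nu : Prob R X) (K : closedSubgroup X), O nu ->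
    ~ mdist K (full_subgroup X) < eta -> (nu (thickening e K) <= (5 / 8)%:E)%E.
Proof.
move=> /haar_thickening_le[r r0 rK].
have e0 : 0 < r / 4 by rewrite divr_gt0.
have r20 : 0 < r / 2 by rewrite divr_gt0.
have [P [c cP]] := finite_coloring X r20.
pose T (A : {ffun 'I_P -> bool}) : set X := [set x | A (c x)].
pose f A := plateau (r / 4) (T A).
have cf A : continuous (f A) by exact: plateau_continuous.
pose O : set (Prob R X) := [set nu : Prob R X | forall A : {ffun 'I_P -> bool},
  `|(\int[mX]_x (f A x : R))%R - (\int[nu]_x (f A x : R))%R| < 1 / 8].
exists (r / 4) => //; exists O.
  pose OA (A : {ffun 'I_P -> bool}) := [set nu : Prob R X |
    `|(\int[mX]_x (f A x : R))%R - (\int[nu]_x (f A x : R))%R| < 1 / 8].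
  suff nOA : forall A, nbhs mX (OA A).
    exact: (@filter_forall (Prob R X) _ OA (nbhs mX) _ nOA).
  move=> A.
  have mXmX : nbhs mX --> mX by exact: cvg_id.
  have FmX : Filter (nbhs mX) by exact: nbhs_filter.
  have cfA := (weak_star_cvgP _ FmX).1 mXmX (f A) (cf A).
  have e8 : 0 < 1 / 8 :> R by rewrite divr_gt0.
  exact: (cvgrPdist_lt _ _).1 cfA _ e8.
move=> nu K Onu Kfar.
pose A : {ffun 'I_P -> bool} :=
  [ffun i => `[< exists2 y : X, (K : set X) y & c y = i >]].
have KT : K `<=` T A.
  by move=> y Ky; rewrite /T/= ffunE; apply/asboolP; exists y.
have TK : T A `<=` thickening (r / 2) K.
  move=> x; rewrite /T/= ffunE => /asboolP[y Ky cyx]; exists y => //.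
  by apply: cP.
have TA0 : T A !=set0 by exists 1%g; apply: KT; exact: csub_1.
have f01 x : 0 <= f A x <= 1.
  by rewrite /f /plateau le_min ler01 le_max lexx/= ge_min lexx.
have nuf : (nu (thickening (r / 4) K) <= (\int[nu]_x (f A x : R))%R%:E)%E.
  apply: probability_le_integral => //; first exact: thickening_open.
    by move=> x; case/andP: (f01 x).
  move=> x [y Ky xy]; have xT : setdist x (T A) / (r / 4) < 1.
    rewrite ltr_pdivrMr// mul1r; apply: setdist_lt; exists y => //.
    exact: KT.
  rewrite /f /plateau le_min lexx le_max.
  by apply/orP; right; lra.
have fmX : ((\int[mX]_x (f A x : R))%R%:E <= (1 / 2)%:E)%E.
  apply: le_trans (rK K Kfar).
  apply: integral_le_probability => //; first exact: thickening_open.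
  move=> x nKx; have xT : 2 <= setdist x (T A) / (r / 4).
    rewrite ler_pdivlMr// leNgt; apply/negP => xT; apply: nKx.
    have {}xT : setdist x (T A) < r / 2 by apply: lt_le_trans xT _; lra.
    have := thickening_add TK (thickening_setdist TA0 xT).
    by rewrite -splitr.
  by rewrite /f /plateau max_l ?min_r//; lra.
apply: (le_trans nuf); rewrite lee_fin in fmX *.
have := Onu A; rewrite ltr_norml => /andP[+ _].
move: (Rintegral nu _ _) (Rintegral mX _ _) fmX => s t t2.
rewrite ltrBrDl => st; apply: ltW.
by apply: (@lt_le_trans _ _ (t + 1 / 8)); [rewrite -ltrBlDr|lra].
Qed.

End FarSubgroups.

(** * Measures supported on microstates versus absorbing subgroups *)

Lemma open_unif_event (R : realType) (T : topologicalType) n (U : 'I_n -> set T)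
    (c : R) : (forall j, open (U j)) ->
  open [set x | c <= unif R [set j | U j x]].
Proof.
move=> oU; rewrite openE => x /= cx.
have : \forall y \near x, forall j, U j x -> U j y.
  apply: filter_forall => j; have [Ujx|nUjx] := pselect (U j x).
    by apply: filterS (open_nbhs_nbhs (conj (oU j) Ujx)) => y Ujy _.
  by apply: filterS filterT => y _ /nUjx.
apply: filterS => y xy; apply: le_trans cx _; apply: le_unif => j; exact: xy.
Qed.

Section NoEquidistribution.
Variables (R : realType) (G : groupType) (G_countable : countable [set: G]).
Variables (X : compactMetricGroupType R).
Variables (a : G -> X -> X) (d : nat -> nat) (d_gt0 : forall k, (0 < d k)%N).
Variables (sigma : forall k, G -> 'S_(d k)).
Variables (omega : set_system nat) (omega_free : free_ultrafilter omega).
Hypothesis a_algebraic : algebraic_action a.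
Variables (mX : Prob R X) (mX_haar : haar mX).
Let ultra_omega : UltraFilter omega := omega_free.1.
Local Existing Instance ultra_omega.

Local Notation eta n := (n.+1%:R^-1 : R).
Local Notation points k := {ptws 'I_(d k) -> X}.

Definition near_microstate (g : G) (e : R) k : set (points k) :=
  [set phi | 1 - e <=
    unif R [set j | mdist (phi (sigma k g j)) (a g (phi j)) < e]].

Lemma point_eval_continuous k (j : 'I_(d k)) :
  continuous (fun phi : points k => phi j).
Proof. exact: (@proj_continuous _ (fun=> X) j). Qed.

Lemma open_mdist_lt (e : R) : open [set p : X * X | mdist p.1 p.2 < e].
Proof.
rewrite openE => -[x y] /= xy; pose r := (e - mdist x y) / 2.
have r0 : 0 < r by rewrite divr_gt0// subr_gt0.
exists (ball x r, ball y r); first by split; exact: nbhsx_ballx.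
move=> [x' y'] [/= xx' yy']; move: (ball_sym xx') yy'; rewrite !ballEmdist/=.
move=> x'x yy'; rewrite (le_lt_trans (metric_triangle _ x _))//.
rewrite (@lt_le_trans _ _ (r + (mdist x y + r)))//; last by rewrite /r; lra.
by rewrite ltrD// (le_lt_trans (metric_triangle _ y _))// ltrD2l.
Qed.

Lemma near_microstate_open (g : G) (e : R) k : open (@near_microstate g e k).
Proof.
have oU j : open [set phi : points k |
    mdist (phi (sigma k g j)) (a g (phi j)) < e]; last exact: open_unif_event.
have c1 : continuous (fun phi : points k => phi (sigma k g j)).
  exact: point_eval_continuous.
have c2 : continuous (fun phi : points k => a g (phi j)).
  move=> phi; apply: (@continuous_comp _ _ _ (fun phi : points k => phi j) (a g)).
    exact: point_eval_continuous.
  exact: (action_continuous a_algebraic).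
pose F (phi : points k) := (phi (sigma k g j), a g (phi j)).
apply: (@open_comp _ _ F [set p : X * X | mdist p.1 p.2 < e]);
  last exact: open_mdist_lt.
by move=> phi _; exact: cvg_pair (c1 phi) (c2 phi).
Qed.

Definition with_high_probability (mu : forall k, Prob R (points k))
    (A : forall k, set (points k)) :=
  forall theta : R, 0 < theta -> omega [set k | (mu k (~` A k) <= theta%:E)%E].

Lemma near_microstate_whp (mu : forall k, Prob R (points k)) (g : G) (e : R) :
  0 < e -> asymptotically_supported a sigma omega mu ->
  with_high_probability mu (near_microstate g e).
Proof.
move=> e0 mu_supp theta theta0.
have mU : <<s @open (X * X)%type >> [set p : X * X | mdist p.1 p.2 < e].
  by apply: sub_sigma_algebra; exact: open_mdist_lt.
have dU : diag_nbhs [set p : X * X | mdist p.1 p.2 < e].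
  move=> x; apply: open_nbhs_nbhs; split; first exact: open_mdist_lt.
  by rewrite /= mdistxx.
have cmu := mu_supp g e _ e0 mU dU.
have nbhs1 : nbhs (1%E : \bar R) [set y | ((1 - theta)%:E < y)%E].
  apply: open_nbhs_nbhs; split; first exact: open_ereal_gt_ereal.
  by rewrite /= lte_fin ltrBlDr ltrDl.
have {}cmu : omega [set k | ((1 - theta)%:E < mu k (@near_microstate g e k))%E].
  exact: cmu nbhs1.
apply: filterS cmu => k /= muk.
have mA : measurable (@near_microstate g e k : set (borel (points k))).
  by apply: open_borel; exact: near_microstate_open.
rewrite probability_setC//.
have Afin : mu k (@near_microstate g e k) \is a fin_num.
  exact: fin_num_measure.
move: muk; rewrite -(fineK Afin) -EFinB lte_fin lee_fin; lra.
Qed.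

Definition near_microstates (g : nat -> G) (e : R) (s : seq nat) k :
    set (points k) :=
  [set phi | forall i, i \in s -> near_microstate (g i) e phi].

Lemma near_microstates_cons (g : nat -> G) (e : R) i s k :
  @near_microstates g e (i :: s) k =
  @near_microstate (g i) e k `&` @near_microstates g e s k.
Proof.
apply/seteqP; split=> phi.
  move=> H; split; first by apply: H; rewrite mem_head.
  by move=> i' i's; apply: H; rewrite inE i's orbT.
by move=> [Hi Hs] i'; rewrite inE => /predU1P[->//|/Hs].
Qed.

Lemma near_microstates_open (g : nat -> G) (e : R) s k :
  open (@near_microstates g e s k).
Proof.
elim: s => [|i s IHs].
  rewrite (_ : @near_microstates g e [::] k = setT); first exact: openT.
  by apply/seteqP; split=> // phi _ i.
rewrite near_microstates_cons; apply: openI => //; exact: near_microstate_open.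
Qed.

Lemma near_microstates_whp (mu : forall k, Prob R (points k)) (g : nat -> G)
    (e : R) s : 0 < e -> asymptotically_supported a sigma omega mu ->
  with_high_probability mu (near_microstates g e s).
Proof.
move=> e0 mu_supp; elim: s => [|i s IHs] theta theta0.
  apply: filterS filterT => k _ /=.
  rewrite (_ : ~` _ = set0) ?measure0 ?lee_fin ?ltW//.
  by apply/seteqP; split=> // phi; apply.
have theta20 : 0 < theta / 2 by rewrite divr_gt0.
have whpi := near_microstate_whp (g i) e0 mu_supp theta20.
apply: filterS2 whpi (IHs _ theta20) => k /= mui mus.
have mA : measurable (~` @near_microstate (g i) e k : set (borel (points k))).
  by apply: measurableC; apply: open_borel; exact: near_microstate_open.
have mB : measurable (~` @near_microstates g e s k : set (borel (points k))).
  by apply: measurableC; apply: open_borel; exact: near_microstates_open.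
rewrite near_microstates_cons setCI (le_trans (measureU2 _ mA mB))//.
by rewrite [theta]splitr EFinD; exact: leeD.
Qed.

(* Otherwise a diagonal choice of bad points would be a sequence of microstates
   that is not absorbed. *)
Lemma near_microstates_absorbed (g : nat -> G)
    (Y : forall k, 'I_(d k) -> closedSubgroup X) (e theta : R) :
  (forall h, exists i, g i = h) -> 0 < e -> 0 < theta ->
  absorbs a sigma omega Y ->
  exists n, omega [set k | forall phi : points k,
    near_microstates g (eta n) (iota 0 n.+1) phi ->
    unif R (~` [set j | thickening e (Y k j) (phi j)]) <= theta].
Proof.
move=> gP e0 theta0 absY; apply/not_notP => nabs.
pose bad n k (phi : points k) :=
  near_microstates g (eta n) (iota 0 n.+1) phi /\
  theta < unif R (~` [set j | thickening e (Y k j) (phi j)]).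
have wbad n : omega [set k | exists phi, @bad n k phi].
  have nw : ~ omega [set k | forall phi : points k,
    near_microstates g (eta n) (iota 0 n.+1) phi ->
    unif R (~` [set j | thickening e (Y k j) (phi j)]) <= theta].
    by move=> wn; apply: nabs; exists n.
  apply: filterS (ultra_not omega_free nw) => k /existsNP[phi /not_implyP[nphi]].
  by move=> /negP; rewrite -ltNge => thetaphi; exists phi.
have [m mP] := diagonal_index omega_free wbad.
have wm n : omega [set k | (n <= m k)%N] by apply: filterS (mP n) => k [].
have wmbad : omega [set k | exists phi, @bad (m k) k phi].
  by apply: filterS (mP 0%N) => k [].
(* The type of configurations varies with [k], hence [cid] at each [k]; the trivial configuration is
   the default where no bad one exists. *)
have phiP k :
    {phi : points k | (exists phi', @bad (m k) k phi') -> @bad (m k) k phi}.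
  apply: cid; have [[phi badphi]|nbad] := pselect (exists phi, @bad (m k) k phi).
    by exists phi.
  by exists (fun=> 1%g) => /nbad.
pose phi k : points k := sval (phiP k).
have badphi : omega [set k | @bad (m k) k (phi k)].
  by apply: filterS wmbad => k; exact: (svalP (phiP k)).
have phiM : topological_microstates a sigma omega phi.
  apply/(microstateP a d_gt0 sigma omega_free) => h r r0; have [i <-] := gP h.
  apply: (unif_most omega_free wm).
  have [n nr] := eta_lt omega_free r0.
  apply: filterS3 (wm i) (wm n) badphi => k im nm [near_phi _].
  have /near_phi : i \in iota 0 (m k).+1 by rewrite mem_iota.
  rewrite /near_microstate/= => phik.
  rewrite unifC// lerBlDr -lerBlDl; apply: le_trans phik _.
  apply: le_unif => j /= phij; rewrite metric_sym (lt_trans phij)//.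
  by rewrite (le_lt_trans _ nr)//; exact: eta_le.
have /(mostP _ d_gt0 omega_free)/(_ _ theta0) absphi := absY phi phiM e e0.
have {}absphi : omega [set k | unif R (~` [set j |
  setdist (phi k j) (Y k j) < e]) <= theta] by exact: absphi.
have [k [/= absk [_ badk]]] := ultra_nempty omega_free (filterI absphi badphi).
have := lt_le_trans badk (le_trans (le_unif R _) absk).
rewrite ltxx => /(_ _)/negP; apply=> //; apply: subsetC => j /thickening_setdist; apply.
by exists 1%g; exact: csub_1.
Qed.

(** The expected proportion of absorbed coordinates is estimated in two ways. Absorption of
    near-microstates makes it at least the square of [1 - theta]; every coordinate in [B] costs at
    least [3 / 8], and [B] has proportion at least [delta / 2]. *)
Lemma no_equidistribution (Y : forall k, 'I_(d k) -> closedSubgroup X)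
    (mu : forall k, Prob R (points k)) :
  absorbs a sigma omega Y -> asymptotically_supported a sigma omega mu ->
  locally_weak_star_cvg omega mu mX ->
  forall r, 0 < r ->
    most R omega (fun k => [set j | mdist (Y k j) (full_subgroup X) < r]).
Proof.
move=> absY mu_supp mu_cvg r r0 delta delta0.
apply/not_notP => nmost.
have {}nmost : omega [set k | delta <
    unif R (~` [set j | mdist (Y k j) (full_subgroup X) < r])].
  apply: filterS (ultra_not omega_free nmost) => k /=.
  by move=> /negP; rewrite -ltNge.
have [e e0 [V mXV Vfar]] := weak_star_thickening_le omega_free mX_haar r0.
have [g gP] := countable_enum G_countable.
(* Then the square of [1 - theta] is at least [1 - delta / 16], which exceeds the upper bound
   [1 - 3 / 16 * delta]. *)
pose theta := delta / 32.
have theta0 : 0 < theta by rewrite divr_gt0.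
have [n wabs] := near_microstates_absorbed gP e0 theta0 absY.
have eta_n : 0 < eta n by [].
have whp := near_microstates_whp g (iota 0 n.+1) eta_n mu_supp theta0.
have delta20 : 0 < delta / 2 by rewrite divr_gt0.
have cV : omega [set k |
    unif R (~` [set j | V (marginal (mu k) j)]) <= delta / 2].
  exact: (mostP _ d_gt0 omega_free _).1 (mu_cvg V mXV) _ delta20.
have [k [[far whpk] [absk Vk]]] := ultra_nempty omega_free
  (filterI (filterI nmost whp) (filterI wabs cV)).
rewrite /= in far whpk absk Vk.
pose E j : set (borel (points k)) := [set phi | thickening e (Y k j) (phi j)].
have mE j : measurable (E j).
  apply: open_borel; apply: (@open_comp _ _ (fun phi : points k => phi j)
    (thickening e (Y k j))); last exact: thickening_open.
  by move=> phi _; exact: point_eval_continuous.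
pose C : set (borel (points k)) := @near_microstates g (eta n) (iota 0 n.+1) k.
have mC : measurable C by apply: open_borel; exact: near_microstates_open.
have dk0 : 0 < (d k)%:R :> R by rewrite ltr0n.
have theta1 : theta <= 1.
  by have := unif_le1 R (~` [set j | mdist (Y k j) (full_subgroup X) < r])
    (d_gt0 k); rewrite /theta; lra.
have c0 : 0 <= (1 - theta) * (d k)%:R by rewrite mulr_ge0// subr_ge0.
have CE phi : C phi -> (1 - theta) * (d k)%:R <= \sum_j `[< E j phi >]%:R.
  move=> /absk; rewrite unifC// lerBlDr -lerBlDl unif_sum ler_pdivlMr//.
have := le_sum_probability (mu k) mC mE c0 CE.
have Cfin : mu k C \is a fin_num by exact: fin_num_measure.
have muC : 1 - theta <= fine (mu k C).
  move: whpk; rewrite probability_setC// -/C -(fineK Cfin) -EFinB lee_fin; lra.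
pose B : set 'I_(d k) := ~` [set j | mdist (Y k j) (full_subgroup X) < r] `&`
  [set j | V (marginal (mu k) j)].
have EB j : (mu k (E j) <= (1 - 3 / 8 * `[< B j >]%:R)%:E)%E.
  case: asboolP => [[Yfar Vj]|_]; last first.
    by rewrite mulr0 subr0; exact: probability_le1.
  apply: le_trans (Vfar (marginal (mu k) j) (Y k j) Vj Yfar) _.
  by rewrite lee_fin mulr1; lra.
rewrite -(fineK Cfin) -EFinM => /le_trans/(_ (lee_sum _ (fun j _ => EB j))).
rewrite sumEFin lee_fin sumrB sumr_const card_ord -mulr_sumr.
have -> : \sum_(j < d k) `[< B j >]%:R = unif R B * (d k)%:R.
  by rewrite unif_sum divfK// gt_eqF.
have Bfar : delta / 2 <= unif R B.
  have := le_trans (le_unif R _) (unifU R B (~` [set j | V (marginal (mu k) j)])).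
  move=> /(_ (~` [set j | mdist (Y k j) (full_subgroup X) < r])) farB.
  have /farB : ~` [set j | mdist (Y k j) (full_subgroup X) < r] `<=`
      B `|` ~` [set j | V (marginal (mu k) j)].
    move=> j Yj; have [Vj|nVj] := pselect (V (marginal (mu k) j)).
      by left.
    by right.
  move: far Vk; move: (unif R _) (unif R _) (unif R _) => s t u; lra.
move=> bound_d.
have bound : (1 - theta) * fine (mu k C) <= 1 - 3 / 8 * unif R B.
  by rewrite -(ler_pM2r dk0) mulrAC [leRHS]mulrBl mul1r -(mulrA (3 / 8)).
have : (1 - theta) * (1 - theta) <= 1 - 3 / 8 * (delta / 2).
  apply: (@le_trans _ _ ((1 - theta) * fine (mu k C))).
    by rewrite ler_wpM2l// subr_ge0.
  by apply: le_trans bound _; rewrite lerB// ler_wpM2l.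
rewrite /theta; nra.
Qed.

End NoEquidistribution.

(** An absorbing [Y] exists in every case, and its convergence to the full subgroup would produce
    the measures excluded by the first condition. Conversely, such measures force every absorbing
    [Y] to converge to the full subgroup. *)
Theorem corollary1p6 (R : realType)
    (G : groupType) (G_countable : countable [set: G])
    (d : nat -> nat) (d_gt0 : forall k, (0 < d k)%N)
    (sigma : forall k, G -> 'S_(d k)) (sigma_sofic : sofic_approximation R sigma)
    (omega : set_system nat) (omega_free : free_ultrafilter omega)
    (X : compactMetricGroupType R) (a : G -> X -> X)
    (a_algebraic : algebraic_action a)
    (mX : Prob R X) (mX_haar : haar mX) :
  (~ exists mu : forall k, Prob R {ptws 'I_(d k) -> X},
       asymptotically_supported a sigma omega mu /\
       locally_weak_star_cvg omega mu mX)
  <->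
  (exists Y : forall k, 'I_(d k) -> closedSubgroup X,
     ~ ((fun k => unif_pushforward R (d_gt0 k) (Y k)) @ omega -->
          point_mass R (full_subgroup X)) /\
     absorbs a sigma omega Y).
Proof.
split=> [no_mu|[Y [Yfull absY]] [mu [mu_supp mu_cvg]]].
  have [Y [absY Y_mu]] := absorbing_or_equidistributed G_countable d_gt0 sigma
    omega_free a_algebraic mX_haar.
  by exists Y; split=> // /(pushforward_cvg_full d_gt0 omega_free Y).1 /Y_mu.
apply: Yfull; apply/(pushforward_cvg_full d_gt0 omega_free).
exact: (no_equidistribution G_countable d_gt0 omega_free a_algebraic mX_haar
  absY mu_supp mu_cvg).
Qed.
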